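(* Let $(X,\phi)$ be a rational dynamical system over an algebraically closed field $k$. Then $\operatorname{sadim}(X,\phi)\le\dim X$.
   Context: A rational dynamical system $(X,\phi)$ over a field $k$ is an irreducible quasi-projective variety $X$ over $k$ together with a dominant rational map $\phi:X\dashrightarrow X$ over $k$. It induces the $k$-endomorphism $\phi^*:k(X)\to k(X)$, $\phi^*(f)=f\circ\phi$. The algebraic dimension $\operatorname{adim}(X,\phi)$ is the transcendence degree over $k$ of $\operatorname{Fix}(k(X),\phi^* )=\{f\in k(X):\phi^*(f)=f\}$. For $X$ geometrically irreducible (automatic when $k$ is algebraically closed), the stabilised algebraic dimension $\operatorname{sadim}(X,\phi)$ is the maximum of $\operatorname{adim}(X\times Y,\phi\times\psi)-\operatorname{adim}(Y,\psi)$ as $(Y,\psi)$ ranges over all (irreducible) rational dynamical systems over $k$. *)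

(* Defs.v *)
(* As k is algebraically closed, varieties over k are identified with their
   sets of k-points in a projective space. *)
From HB Require Import structures.
From mathcomp Require Import all_boot all_order all_algebra.
From mathcomp Require Import generic_quotient.
From mathcomp Require Import ring.
From mathcomp Require Import mpoly.
From mathcomp Require Import boolp.

Set Implicit Arguments.
Unset Strict Implicit.
Unset Printing Implicit Defensive.
Import GRing.Theory.
Local Open Scope ring_scope.
Local Open Scope quotient_scope.

Section Varieties.
Variable k : closedFieldType.

(* A subset of the projective space with N homogeneous coordinates (i.e. of
   P^(N-1)) is given by the set of all the nonzero vectors representing its
   points; all the subsets used below are invariant under scaling because they
   are defined by homogeneous polynomials. *)
Section Sets.
Variable N : nat.
Implicit Types (S A B : 'rV[k]_N -> Prop) (T : {mpoly k[N]} -> Prop).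

Definition forms T := forall p, T p -> exists d : nat, p \is d.-homog.

Definition zeros T (x : 'rV[k]_N) : Prop :=
  x <> 0 /\ forall p, T p -> p.@[x 0] = 0.

Definition proj_closed A : Prop :=
  exists T, forms T /\ forall x, A x <-> zeros T x.

Definition locally_closed S : Prop :=
  exists A B, [/\ proj_closed A, proj_closed B & forall x, S x <-> A x /\ ~ B x].

Definition irreducible S : Prop :=
  (exists x, S x) /\
  forall A B, proj_closed A -> proj_closed B ->
    (forall x, S x -> A x \/ B x) ->
    (forall x, S x -> A x) \/ (forall x, S x -> B x).

Record variety := Variety {
  points :> 'rV[k]_N -> Prop;
  variety_locally_closed : locally_closed points;
  variety_irreducible : irreducible points }.

Definition vanishes (X : variety) (p : {mpoly k[N]}) : Prop :=
  forall x, X x -> p.@[x 0] = 0.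

Lemma zeros_closed T : forms T -> proj_closed (zeros T).
Proof. by move=> hT; exists T. Qed.

Lemma form_zeros_closed d (p : {mpoly k[N]}) :
  p \is d.-homog -> proj_closed (zeros (eq^~ p)).
Proof. by move=> hp; apply: zeros_closed => q ->; exists d. Qed.

Lemma variety_neq0 (X : variety) x : X x -> x <> 0.
Proof.
have [A [B [[T [_ hT]] _ h]]] := variety_locally_closed X.
by move=> /h[/hT[]].
Qed.

Lemma meval_scale d (p : {mpoly k[N]}) c (x : 'rV[k]_N) :
  p \is d.-homog -> p.@[(c *: x) 0] = c ^+ d * p.@[x 0].
Proof.
move=> hp; rewrite !mevalE mulr_sumr; apply: eq_big_seq => m hm.
rewrite mulrCA; congr (_ * _).
have <- : mdeg m = d by exact: (dhomog_mf hp hm).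
under eq_bigr do rewrite mxE exprMn.
by rewrite big_split /= prodrXr -mdegE.
Qed.

Lemma closed_scale A c x : proj_closed A -> c != 0 -> A (c *: x) <-> A x.
Proof.
move=> [T [hT hA]] c0; split=> /hA[x0 hx]; apply/hA; split.
- by move=> xE; apply: x0; rewrite xE scaler0.
- move=> p Tp; have [d hd] := hT p Tp.
  have /eqP := hx p Tp; rewrite (meval_scale _ _ hd) mulf_eq0.
  by rewrite expf_eq0 (negPf c0) andbF => /eqP.
- by move/eqP; rewrite scaler_eq0 (negPf c0) => /eqP.
- by move=> p Tp; have [d hd] := hT p Tp; rewrite (meval_scale _ _ hd) hx ?mulr0.
Qed.

Lemma variety_scale (X : variety) c x : c != 0 -> X (c *: x) <-> X x.
Proof.
have [A [B [hA hB h]]] := variety_locally_closed X.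
move=> c0; have := closed_scale x hA c0; have := closed_scale x hB c0.
by move=> iB iA; split=> /h hx; apply/h; tauto.
Qed.

Lemma vanishesM (X : variety) d e (p q : {mpoly k[N]}) :
  p \is d.-homog -> q \is e.-homog ->
  vanishes X (p * q) -> vanishes X p \/ vanishes X q.
Proof.
move=> hp hq hpq; have [_ irr] := variety_irreducible X.
have [x Xx|h|h] := irr _ _ (form_zeros_closed hp) (form_zeros_closed hq).
- have /eqP := hpq x Xx; rewrite mevalM mulf_eq0 => /orP[] /eqP hx.
    by left; split=> [|r ->]; [apply: variety_neq0 Xx|].
  by right; split=> [|r ->]; [apply: variety_neq0 Xx|].
- by left=> x /h[_]; apply.
- by right=> x /h[_]; apply.
Qed.

Lemma vanishesB (X : variety) p q :
  vanishes X p -> vanishes X q -> vanishes X (p - q).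
Proof. by move=> hp hq x Xx; rewrite mevalB hp ?hq ?subr0. Qed.

Lemma vanishesD (X : variety) p q :
  vanishes X p -> vanishes X q -> vanishes X (p + q).
Proof. by move=> hp hq x Xx; rewrite mevalD hp ?hq ?addr0. Qed.

Lemma vanishesMl (X : variety) p q : vanishes X p -> vanishes X (p * q).
Proof. by move=> hp x Xx; rewrite mevalM hp ?mul0r. Qed.

Lemma vanishes0 (X : variety) : vanishes X 0.
Proof. by move=> x _; rewrite meval0. Qed.

Lemma not_vanishes1 (X : variety) : ~ vanishes X 1.
Proof.
have [[x Xx] _] := variety_irreducible X.
by move=> /(_ x Xx)/eqP; rewrite meval1 oner_eq0.
Qed.

End Sets.

(* The function field k(X): quotients num/den of forms of the same degree,
   den not vanishing identically on X, up to num * den' = num' * den on X. *)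
Section FunctionField.
Variables (N : nat) (X : variety N).

Record ratio := Ratio {
  num : {mpoly k[N]};
  den : {mpoly k[N]};
  rdeg : nat;
  num_homog : num \is rdeg.-homog;
  den_homog : den \is rdeg.-homog;
  den_neq0 : ~ vanishes X den }.

HB.instance Definition _ := gen_eqMixin ratio.
HB.instance Definition _ := gen_choiceMixin ratio.

Definition equivr (f g : ratio) : bool :=
  `[< vanishes X (num f * den g - num g * den f) >].

Lemma equivr_refl : reflexive equivr.
Proof. by move=> f; apply/asboolP; rewrite subrr; apply: vanishes0. Qed.

Lemma equivr_sym : ssrbool.symmetric equivr.
Proof.
move=> f g; apply/asboolP/asboolP => h x Xx; apply: oppr_inj;
  by rewrite -mevalN opprB oppr0 h.
Qed.

Lemma equivr_trans : transitive equivr.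
Proof.
move=> g f h /asboolP fg /asboolP gh; apply/asboolP.
have : vanishes X (den g * (num f * den h - num h * den f)).
  have -> : den g * (num f * den h - num h * den f) =
    (num f * den g - num g * den f) * den h +
    (num g * den h - num h * den g) * den f by ring.
  by apply: vanishesD; apply: vanishesMl.
case/(vanishesM (den_homog g) (d := rdeg g) (e := rdeg f + rdeg h)) => //.
  apply: rpredB; first by apply: dhomogM; [apply: num_homog|apply: den_homog].
  by rewrite addnC; apply: dhomogM; [apply: num_homog|apply: den_homog].
by move/(@den_neq0 g).
Qed.

Canonical equivr_equiv := EquivRel equivr equivr_refl equivr_sym equivr_trans.

Definition ratfun := {eq_quot equivr}.
HB.instance Definition _ : EqQuotient _ equivr ratfun := EqQuotient.on ratfun.
HB.instance Definition _ := Choice.on ratfun.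

Lemma ratfunP (f g : ratio) :
  \pi_ratfun f = \pi_ratfun g <-> vanishes X (num f * den g - num g * den f).
Proof.
split; first by move/eqmodP/asboolP.
by move=> h; apply/eqmodP/asboolP.
Qed.

Lemma repr_pi_ratfun (f : ratio) :
  vanishes X (num (repr (\pi_ratfun f)) * den f
              - num f * den (repr (\pi_ratfun f))).
Proof. by apply/ratfunP; rewrite reprK. Qed.

Fact den_mul (f g : ratio) : ~ vanishes X (den f * den g).
Proof.
by case/(vanishesM (den_homog f) (den_homog g)) => /den_neq0.
Qed.

Fact const_homog (c : k) : (c%:MP : {mpoly k[N]}) \is 0.-homog.
Proof. by rewrite -[c%:MP]mulr1 mul_mpolyC dhomogZ ?dhomog1. Qed.

Definition ratio_const (c : k) : ratio :=
  Ratio (const_homog c) (dhomog1 _ _) (@not_vanishes1 _ X).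

Fact num_add_homog (f g : ratio) :
  num f * den g + num g * den f \is (rdeg f + rdeg g).-homog.
Proof.
apply: rpredD; first by apply: dhomogM; [apply: num_homog|apply: den_homog].
by rewrite addnC; apply: dhomogM; [apply: num_homog|apply: den_homog].
Qed.

Definition ratio_add (f g : ratio) : ratio :=
  Ratio (num_add_homog f g) (dhomogM (den_homog f) (den_homog g))
    (@den_mul f g).

Fact num_opp_homog (f : ratio) : - num f \is (rdeg f).-homog.
Proof. by rewrite dhomogN; apply: num_homog. Qed.

Definition ratio_opp (f : ratio) : ratio :=
  Ratio (num_opp_homog f) (den_homog f) (@den_neq0 f).

Definition ratio_mul (f g : ratio) : ratio :=
  Ratio (dhomogM (num_homog f) (num_homog g))
    (dhomogM (den_homog f) (den_homog g)) (@den_mul f g).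

Definition ratio_inv (f : ratio) : ratio :=
  match pselect (vanishes X (num f)) with
  | left _ => ratio_const 0
  | right h => Ratio (den_homog f) (num_homog f) h
  end.

Definition ratfun_const (c : k) : ratfun := \pi_ratfun (ratio_const c).
Definition ratfun_add := lift_op2 ratfun ratio_add.
Definition ratfun_opp := lift_op1 ratfun ratio_opp.
Definition ratfun_mul := lift_op2 ratfun ratio_mul.
Definition ratfun_inv := lift_op1 ratfun ratio_inv.

Fact pi_add : {morph \pi : x y / ratio_add x y >-> ratfun_add x y}.
Proof.
move=> f g; unlock ratfun_add; apply/ratfunP => /=.
have hf := repr_pi_ratfun f; have hg := repr_pi_ratfun g.
set f' := repr _ in hf *; set g' := repr _ in hg *.
have -> : (num f * den g + num g * den f) * (den f' * den g') -
  (num f' * den g' + num g' * den f') * (den f * den g) =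
  0 - (num f' * den f - num f * den f') * (den g * den g')
  - (num g' * den g - num g * den g') * (den f * den f') by ring.
by apply: vanishesB; [apply: vanishesB; first exact: vanishes0|];
  apply: vanishesMl.
Qed.
Canonical pi_add_morph := PiMorph2 pi_add.

Fact pi_opp : {morph \pi : x / ratio_opp x >-> ratfun_opp x}.
Proof.
move=> f; unlock ratfun_opp; apply/ratfunP => /=.
have hf := repr_pi_ratfun f; set f' := repr _ in hf *.
have -> : - num f * den f' - - num f' * den f =
  num f' * den f - num f * den f' by ring.
by [].
Qed.
Canonical pi_opp_morph := PiMorph1 pi_opp.

Fact pi_mul : {morph \pi : x y / ratio_mul x y >-> ratfun_mul x y}.
Proof.
move=> f g; unlock ratfun_mul; apply/ratfunP => /=.
have hf := repr_pi_ratfun f; have hg := repr_pi_ratfun g.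
set f' := repr _ in hf *; set g' := repr _ in hg *.
have -> : num f * num g * (den f' * den g') - num f' * num g' * (den f * den g) =
  0 - (num f' * den f - num f * den f') * (num g * den g')
  - (num g' * den g - num g * den g') * (num f' * den f) by ring.
by apply: vanishesB; [apply: vanishesB; first exact: vanishes0|];
  apply: vanishesMl.
Qed.
Canonical pi_mul_morph := PiMorph2 pi_mul.

Lemma equiv_vanishes f g : vanishes X (num f * den g - num g * den f) ->
  vanishes X (num f) -> vanishes X (num g).
Proof.
move=> h hf.
have : vanishes X (num g * den f).
  have -> : num g * den f = num f * den g - (num f * den g - num g * den f)
    by ring.
  by apply: vanishesB => //; apply: vanishesMl.
by case/(vanishesM (num_homog g) (den_homog f)) => // /den_neq0.
Qed.

Fact pi_inv : {morph \pi : x / ratio_inv x >-> ratfun_inv x}.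
Proof.
move=> f; unlock ratfun_inv; apply/ratfunP.
have hf := repr_pi_ratfun f; set f' := repr _ in hf *.
have hf' : vanishes X (num f * den f' - num f' * den f).
  by apply/ratfunP; rewrite reprK.
rewrite /ratio_inv; case: pselect => h; case: pselect => h' /=.
- by rewrite subrr; apply: vanishes0.
- by case: h'; apply: equiv_vanishes h.
- by case: h; apply: equiv_vanishes h'.
- have -> : den f * num f' - den f' * num f = num f' * den f - num f * den f'
    by ring.
  by [].
Qed.
Canonical pi_inv_morph := PiMorph1 pi_inv.

Local Ltac pi_ring :=
  rewrite ?piE; apply/ratfunP => /=; rewrite ?mpolyC0 ?mpolyC1;
  match goal with |- vanishes _ ?p =>
    have -> : p = 0 by ring end; exact: vanishes0.

Fact ratfun_addA : associative ratfun_add.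
Proof.
by elim/quotW=> f; elim/quotW=> g; elim/quotW=> h; rewrite !piE; pi_ring.
Qed.
Fact ratfun_addC : commutative ratfun_add.
Proof. by elim/quotW=> f; elim/quotW=> g; rewrite !piE; pi_ring. Qed.
Fact ratfun_add0 : left_id (ratfun_const 0) ratfun_add.
Proof. by elim/quotW=> f; rewrite /ratfun_const !piE; pi_ring. Qed.
Fact ratfun_addN : left_inverse (ratfun_const 0) ratfun_opp ratfun_add.
Proof. by elim/quotW=> f; rewrite /ratfun_const !piE; pi_ring. Qed.

HB.instance Definition _ := GRing.isZmodule.Build ratfun
  ratfun_addA ratfun_addC ratfun_add0 ratfun_addN.

Fact ratfun_mulA : associative ratfun_mul.
Proof.
by elim/quotW=> f; elim/quotW=> g; elim/quotW=> h; rewrite !piE; pi_ring.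
Qed.
Fact ratfun_mulC : commutative ratfun_mul.
Proof. by elim/quotW=> f; elim/quotW=> g; rewrite !piE; pi_ring. Qed.
Fact ratfun_mul1 : left_id (ratfun_const 1) ratfun_mul.
Proof. by elim/quotW=> f; rewrite /ratfun_const !piE; pi_ring. Qed.
Fact ratfun_mulD : left_distributive ratfun_mul ratfun_add.
Proof.
by elim/quotW=> f; elim/quotW=> g; elim/quotW=> h; rewrite !piE; pi_ring.
Qed.
Fact ratfun_1neq0 : ratfun_const 1 != ratfun_const 0.
Proof.
apply/eqP => /ratfunP /=; rewrite mpolyC1 mpolyC0 mulr1 mul0r subr0.
exact: not_vanishes1.
Qed.

HB.instance Definition _ := GRing.Zmodule_isComNzRing.Build ratfun
  ratfun_mulA ratfun_mulC ratfun_mul1 ratfun_mulD ratfun_1neq0.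

Fact ratfun_mulV (f : ratfun) :
  f != ratfun_const 0 -> ratfun_mul (ratfun_inv f) f = ratfun_const 1.
Proof.
elim/quotW: f => f /eqP hf; rewrite /ratfun_const !piE.
have {}hf : ~ vanishes X (num f).
  move=> h; apply: hf; apply/ratfunP => /=.
  by rewrite mpolyC0 mulr1 mul0r subr0.
rewrite /ratio_inv; case: pselect => // h; pi_ring.
Qed.
Fact ratfun_inv0 : ratfun_inv (ratfun_const 0) = ratfun_const 0.
Proof.
rewrite /ratfun_const !piE /ratio_inv; case: pselect => //= -[].
by rewrite mpolyC0; apply: vanishes0.
Qed.

HB.instance Definition _ := GRing.ComNzRing_isField.Build ratfun
  ratfun_mulV ratfun_inv0.

Fact ratfun_const_zmod : zmod_morphism ratfun_const.
Proof.
move=> a b; rewrite /ratfun_const -[X in _ = _ + X]pi_opp -[RHS]pi_add.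
apply/ratfunP => /=; rewrite mpolyCB.
match goal with |- vanishes _ ?p => have -> : p = 0 by ring end.
exact: vanishes0.
Qed.
HB.instance Definition _ :=
  GRing.isZmodMorphism.Build k ratfun ratfun_const ratfun_const_zmod.

Fact ratfun_const_monoid : monoid_morphism ratfun_const.
Proof.
split=> [//|a b]; rewrite /ratfun_const -[RHS]pi_mul.
apply/ratfunP => /=; rewrite mpolyCM.
match goal with |- vanishes _ ?p => have -> : p = 0 by ring end.
exact: vanishes0.
Qed.
HB.instance Definition _ :=
  GRing.isMonoidMorphism.Build k ratfun ratfun_const ratfun_const_monoid.

End FunctionField.

Section RationalMaps.

Lemma comp_homog N M (F : M.-tuple {mpoly k[N]}) d e (p : {mpoly k[M]}) :
  p \is d.-homog -> (forall j, tnth F j \is e.-homog) ->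
  p \mPo F \is (e * d).-homog.
Proof.
move=> hp hF; rewrite comp_mpolyE big_seq; apply: rpred_sum => m hm.
apply: dhomogZ; have <- : mdeg m = d by exact: (dhomog_mf hp hm).
rewrite mdegE big_distrr /=.
elim/big_rec2: _ => [|i q n _ hq]; first exact: dhomog1.
by apply: dhomogM => //; apply: dhomogMn.
Qed.

Definition map_at N M (F : M.-tuple {mpoly k[N]}) (x : 'rV[k]_N) : 'rV[k]_M :=
  \row_j (tnth F j).@[x 0].

Lemma comp_meval N M (F : M.-tuple {mpoly k[N]}) (p : {mpoly k[M]})
    (x : 'rV[k]_N) :
  (p \mPo F).@[x 0] = p.@[map_at F x 0].
Proof.
by rewrite comp_mpoly_meval; apply: meval_eq => j; rewrite mxE.
Qed.

Variables (N M : nat) (X : variety N) (Y : variety M).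

(* A rational map X --> Y is represented by a tuple of forms of the same
   degree that sends the points of a nonempty open subset of X into Y. *)
Record ratmap := RatMap {
  ratmap_form :> M.-tuple {mpoly k[N]};
  ratmap_deg : nat;
  ratmap_homog : forall j, tnth ratmap_form j \is ratmap_deg.-homog;
  ratmap_generic : exists B, [/\ proj_closed B, exists x, X x /\ ~ B x &
    forall x, X x -> ~ B x -> Y (map_at ratmap_form x)] }.

Variable f : ratmap.

Definition dominant : Prop :=
  forall A, proj_closed A ->
    (forall x, X x -> Y (map_at f x) -> A (map_at f x)) ->
    forall y, Y y -> A y.

Lemma generic_vanishes d (q : {mpoly k[N]}) : q \is d.-homog ->
  (forall x, X x -> Y (map_at f x) -> q.@[x 0] = 0) -> vanishes X q.
Proof.
move=> hq h; have [B [cB [x0 [Xx0 nBx0]] hB]] := ratmap_generic f.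
have [_ irr] := variety_irreducible X.
have [x Xx|h1|h1] := irr _ _ cB (form_zeros_closed hq).
- case: (pselect (B x)) => [|nBx]; first by left.
  right; split; first exact: variety_neq0 Xx.
  by move=> p ->; apply: h => //; apply: hB.
- by case: nBx0; apply: h1.
- by move=> x /h1[_]; apply.
Qed.

Lemma comp_vanishes d (p : {mpoly k[M]}) : p \is d.-homog ->
  vanishes Y p -> vanishes X (p \mPo f).
Proof.
move=> hp h; apply: (generic_vanishes (comp_homog hp (ratmap_homog f))).
by move=> x _ /h; rewrite comp_meval.
Qed.

Hypothesis f_dominant : dominant.

Fact comp_den_neq0 (g : ratio Y) : ~ vanishes X (den g \mPo f).
Proof.
move=> h; apply: (@den_neq0 _ _ g) => y Yy.
suff [_] : zeros (eq^~ (den g)) y by apply.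
apply: f_dominant Yy; first exact: form_zeros_closed (den_homog g).
move=> x Xx Yfx; split=> [|p ->]; first exact: variety_neq0 Yfx.
by rewrite -comp_meval h.
Qed.

Definition pullback_ratio (g : ratio Y) : ratio X :=
  Ratio (comp_homog (num_homog g) (ratmap_homog f))
    (comp_homog (den_homog g) (ratmap_homog f)) (@comp_den_neq0 g).

Definition pullback (g : ratfun Y) : ratfun X :=
  \pi_(ratfun X) (pullback_ratio (repr g)).

Lemma pullback_pi (g : ratio Y) :
  pullback (\pi_(ratfun Y) g) = \pi_(ratfun X) (pullback_ratio g).
Proof.
apply/ratfunP => /=; set g' := repr _.
have h : vanishes Y (num g' * den g - num g * den g').
  by apply/ratfunP; rewrite reprK.
rewrite -!rmorphM -rmorphB; apply: (@comp_vanishes (rdeg g' + rdeg g)) h.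
apply: rpredB; first by apply: dhomogM; [apply: num_homog|apply: den_homog].
by rewrite addnC; apply: dhomogM; [apply: num_homog|apply: den_homog].
Qed.

Lemma dominant_open A d (h : {mpoly k[N]}) :
  proj_closed A -> h \is d.-homog -> ~ vanishes X h ->
  (forall x, X x -> h.@[x 0] <> 0 -> Y (map_at f x) -> A (map_at f x)) ->
  forall y, Y y -> A y.
Proof.
move=> cA hh nh hA; apply: f_dominant => // x Xx Yfx.
have [T [hT iA]] := cA; apply/iA; split=> [|p Tp].
  exact: variety_neq0 Yfx.
have [e he] := hT p Tp; have hc := comp_homog he (ratmap_homog f).
rewrite -comp_meval.
have : vanishes X (h * (p \mPo f)).
  apply: (generic_vanishes (dhomogM hh hc)) => z Xz Yfz.
  rewrite mevalM; case: (eqVneq h.@[z 0] 0) => [->|/eqP hz].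
    by rewrite mul0r.
  by have /iA[_ /(_ p Tp)] := hA z Xz hz Yfz; rewrite -comp_meval => ->; rewrite mulr0.
by case/(vanishesM hh hc) => // ->.
Qed.

End RationalMaps.

Section Products.

Section Segre.
Variables (N M : nat).

Definition segre (x : 'rV[k]_N) (y : 'rV[k]_M) : 'rV[k]_(N * M) :=
  mxvec (x^T *m y).

Lemma segreE x y i j : segre x y 0 (mxvec_index i j) = x 0 i * y 0 j.
Proof. by rewrite mxvecE mxE big_ord1 mxE. Qed.

Lemma row_neq0 n (x : 'rV[k]_n) : x <> 0 -> exists i, x 0 i != 0.
Proof.
by move/eqP/rV0Pn.
Qed.

Lemma row_coord_neq0 n (x : 'rV[k]_n) i : x 0 i != 0 -> x <> 0.
Proof. by move=> /[swap] ->; rewrite mxE eqxx. Qed.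

Lemma segre_neq0 x y : x <> 0 -> y <> 0 -> segre x y <> 0.
Proof.
move=> /row_neq0[i hi] /row_neq0[j hj].
by apply: (@row_coord_neq0 _ _ (mxvec_index i j)); rewrite segreE mulf_neq0.
Qed.

(* The homogeneous coordinates of P^(N-1) x P^(M-1) in its Segre embedding
   form an N x M matrix; zcol b and zrow a are its columns and rows, which are
   proportional to the coordinates on the factors. *)
Definition zcol (b : 'I_M) : N.-tuple {mpoly k[N * M]} :=
  [tuple 'X_(mxvec_index i b) | i < N].
Definition zrow (a : 'I_N) : M.-tuple {mpoly k[N * M]} :=
  [tuple 'X_(mxvec_index a j) | j < M].

Lemma X_homog n (i : 'I_n) : ('X_i : {mpoly k[n]}) \is 1.-homog.
Proof. by rewrite dhomogX /= mdeg1. Qed.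

Lemma zcol_homog b i : tnth (zcol b) i \is 1.-homog.
Proof. by rewrite tnth_mktuple X_homog. Qed.
Lemma zrow_homog a j : tnth (zrow a) j \is 1.-homog.
Proof. by rewrite tnth_mktuple X_homog. Qed.

Lemma comp_zcol_homog d b p : p \is d.-homog -> p \mPo zcol b \is d.-homog.
Proof. by move=> hp; rewrite -[d]mul1n; apply: comp_homog (zcol_homog b). Qed.
Lemma comp_zrow_homog d a p : p \is d.-homog -> p \mPo zrow a \is d.-homog.
Proof. by move=> hp; rewrite -[d]mul1n; apply: comp_homog (zrow_homog a). Qed.

Lemma zcol_segre b x y : map_at (zcol b) (segre x y) = y 0 b *: x.
Proof.
by apply/rowP => i; rewrite [LHS]mxE [RHS]mxE tnth_mktuple mevalXU segreE mulrC.
Qed.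
Lemma zrow_segre a x y : map_at (zrow a) (segre x y) = x 0 a *: y.
Proof.
by apply/rowP => i; rewrite [LHS]mxE [RHS]mxE tnth_mktuple mevalXU segreE.
Qed.

Lemma comp_zcolE d b p x y : p \is d.-homog ->
  (p \mPo zcol b).@[segre x y 0] = y 0 b ^+ d * p.@[x 0].
Proof. by move=> hp; rewrite comp_meval zcol_segre (meval_scale _ _ hp). Qed.
Lemma comp_zrowE d a p x y : p \is d.-homog ->
  (p \mPo zrow a).@[segre x y 0] = x 0 a ^+ d * p.@[y 0].
Proof. by move=> hp; rewrite comp_meval zrow_segre (meval_scale _ _ hp). Qed.

Lemma segre_closed A C : proj_closed A -> proj_closed C ->
  proj_closed (fun z => exists x y, [/\ A x, C y & z = segre x y]).
Proof.
move=> [TA [hTA iA]] [TC [hTC iC]].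
exists (fun p => [\/ exists i j i' j', p =
    'X_(mxvec_index i j) * 'X_(mxvec_index i' j') -
    'X_(mxvec_index i j') * 'X_(mxvec_index i' j),
  exists q b, TA q /\ p = q \mPo zcol b |
  exists q a, TC q /\ p = q \mPo zrow a]); split.
  move=> p [[i [j [i' [j' ->]]]]|[q [b [/hTA[d hq] ->]]]|[q [a [/hTC[d hq] ->]]]].
  - by exists (1 + 1)%N; apply: rpredB; apply: dhomogM; apply: X_homog.
  - by exists d; apply: comp_zcol_homog.
  - by exists d; apply: comp_zrow_homog.
move=> z; split.
  move=> [x [y [/iA[x0 hx] /iC[y0 hy] ->]]]; split; first exact: segre_neq0.
  move=> p [[i [j [i' [j' ->]]]]|[q [b [Tq ->]]]|[q [a [Tq ->]]]].
  - by rewrite mevalB !mevalM !mevalXU !segreE; ring.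
  - by have [d hq] := hTA q Tq; rewrite (comp_zcolE _ _ _ hq) hx ?mulr0.
  - by have [d hq] := hTC q Tq; rewrite (comp_zrowE _ _ _ hq) hy ?mulr0.
move=> [/row_neq0[l]]; case/mxvec_indexP: l => a b hab hz.
have hr i j : z 0 (mxvec_index i j) =
    (z 0 (mxvec_index a b))^-1 * z 0 (mxvec_index i b) * z 0 (mxvec_index a j).
  apply: (mulfI hab); rewrite -mulrA mulVKf //.
  have /eqP := hz _ (Or31 _ _ (ex_intro _ a (ex_intro _ b
    (ex_intro _ i (ex_intro _ j erefl))))).
  by rewrite mevalB !mevalM !mevalXU subr_eq0 => /eqP ->; rewrite mulrC.
pose x := map_at (zcol b) z; pose y := map_at (zrow a) z.
have xE i : x 0 i = z 0 (mxvec_index i b).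
  by rewrite mxE tnth_mktuple mevalXU.
have yE j : y 0 j = z 0 (mxvec_index a j).
  by rewrite mxE tnth_mktuple mevalXU.
have c0 : (z 0 (mxvec_index a b))^-1 != 0 by rewrite invr_eq0.
exists ((z 0 (mxvec_index a b))^-1 *: x), y; split.
- apply/closed_scale => //; first by exists TA.
  apply/iA; split=> [|p Tp].
    by apply: (@row_coord_neq0 _ _ a); rewrite xE.
  by rewrite -comp_meval hz //; apply: Or32; exists p, b.
- apply/iC; split=> [|p Tp].
    by apply: (@row_coord_neq0 _ _ b); rewrite yE.
  by rewrite -comp_meval hz //; apply: Or33; exists p, a.
- apply/rowP => l; case/mxvec_indexP: l => i j.
  by rewrite segreE [X in _ = X * _]mxE xE yE.
Qed.

Lemma closed_form n (B : 'rV[k]_n -> Prop) x : proj_closed B -> x <> 0 ->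
  ~ B x -> exists d (q : {mpoly k[n]}),
    [/\ q \is d.-homog, q.@[x 0] != 0 & forall y, B y -> q.@[y 0] = 0].
Proof.
move=> [T [hT iB]] x0 nBx.
have /existsNP[q /not_implyP[Tq hq]] : ~ forall q, T q -> q.@[x 0] = 0.
  by move=> h; apply: nBx; apply/iB.
have [d hd] := hT q Tq; exists d, q; split=> //; first exact/eqP.
by move=> y /iB[_]; apply.
Qed.

Lemma segre_union_closed B D : proj_closed B -> proj_closed D ->
  exists E, proj_closed E /\ forall x y, x <> 0 -> y <> 0 ->
    E (segre x y) <-> B x \/ D y.
Proof.
move=> cB cD; have [TB [hTB iB]] := cB; have [TD [hTD iD]] := cD.
exists (zeros (fun p => exists q q' a b,
  [/\ TB q, TD q' & p = (q \mPo zcol b) * (q' \mPo zrow a)])); split.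
  apply: zeros_closed => p [q [q' [a [b [/hTB[d hd] /hTD[e he] ->]]]]].
  by exists (d + e)%N; apply: dhomogM;
    [apply: comp_zcol_homog|apply: comp_zrow_homog].
move=> x y x0 y0; split.
  move=> [_ hz]; apply: contrapT => /not_orP[nB nD].
  have /existsNP[q /not_implyP[Tq /eqP hq]] : ~ forall q, TB q -> q.@[x 0] = 0.
    by move=> h; apply: nB; apply/iB.
  have /existsNP[q' /not_implyP[Tq' /eqP hq']] :
      ~ forall q, TD q -> q.@[y 0] = 0.
    by move=> h; apply: nD; apply/iD.
  have [a ha] := row_neq0 x0; have [b hb] := row_neq0 y0.
  have [d hd] := hTB q Tq; have [e he] := hTD q' Tq'.
  have /eqP := hz _ (ex_intro _ q (ex_intro _ q' (ex_intro _ a (ex_intro _ b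
    (And3 Tq Tq' erefl))))).
  rewrite mevalM (comp_zcolE _ _ _ hd) (comp_zrowE _ _ _ he) !mulf_eq0.
  by rewrite !expf_eq0 (negPf ha) (negPf hb) (negPf hq) (negPf hq') !andbF.
move=> h; split; first exact: segre_neq0.
move=> _ [q [q' [a [b [Tq Tq' ->]]]]].
have [d hd] := hTB q Tq; have [e he] := hTD q' Tq'.
rewrite mevalM (comp_zcolE _ _ _ hd) (comp_zrowE _ _ _ he).
by case: h => [/iB[_ ->]|/iD[_ ->]] //; rewrite !(mulr0, mul0r).
Qed.

Definition lsegre (x : 'rV[k]_N) : (N * M).-tuple {mpoly k[M]} :=
  [tuple mxvec (\matrix_(i < N, j < M) (x 0 i *: 'X_j)) 0 l | l < N * M].
Definition rsegre (y : 'rV[k]_M) : (N * M).-tuple {mpoly k[N]} :=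
  [tuple mxvec (\matrix_(i < N, j < M) (y 0 j *: 'X_i)) 0 l | l < N * M].

Lemma lsegreE x y : map_at (lsegre x) y = segre x y.
Proof.
apply/rowP => l; case/mxvec_indexP: l => i j.
by rewrite segreE mxE tnth_mktuple mxvecE mxE mevalZ mevalXU.
Qed.
Lemma rsegreE x y : map_at (rsegre y) x = segre x y.
Proof.
apply/rowP => l; case/mxvec_indexP: l => i j.
by rewrite segreE mxE tnth_mktuple mxvecE mxE mevalZ mevalXU mulrC.
Qed.
Lemma lsegre_homog x l : tnth (lsegre x) l \is 1.-homog.
Proof.
rewrite tnth_mktuple; case/mxvec_indexP: l => i j.
by rewrite mxvecE mxE dhomogZ ?X_homog.
Qed.
Lemma rsegre_homog y l : tnth (rsegre y) l \is 1.-homog.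
Proof.
rewrite tnth_mktuple; case/mxvec_indexP: l => i j.
by rewrite mxvecE mxE dhomogZ ?X_homog.
Qed.

Lemma lfiber_closed A (S : 'rV[k]_N -> Prop) : proj_closed A ->
  (forall x, S x -> x <> 0) ->
  proj_closed (fun y => y <> 0 /\ forall x, S x -> A (segre x y)).
Proof.
move=> [T [hT iA]] S0.
exists (fun p => exists q x, [/\ T q, S x & p = q \mPo lsegre x]); split.
  move=> _ [q [x [/hT[d hd] _ ->]]]; exists (1 * d)%N.
  by apply: comp_homog hd (lsegre_homog x).
move=> y; split=> -[y0 h]; split=> //.
  by move=> _ [q [x [Tq /h/iA[_ hq] ->]]]; rewrite comp_meval lsegreE hq.
move=> x Sx; apply/iA; split; first by apply: segre_neq0 => //; apply: S0.
by move=> q Tq; rewrite -lsegreE -comp_meval; apply: h; exists q, x.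
Qed.

Lemma rfiber_closed A (S : 'rV[k]_M -> Prop) : proj_closed A ->
  (forall y, S y -> y <> 0) ->
  proj_closed (fun x => x <> 0 /\ forall y, S y -> A (segre x y)).
Proof.
move=> [T [hT iA]] S0.
exists (fun p => exists q y, [/\ T q, S y & p = q \mPo rsegre y]); split.
  move=> _ [q [y [/hT[d hd] _ ->]]]; exists (1 * d)%N.
  by apply: comp_homog hd (rsegre_homog y).
move=> x; split=> -[x0 h]; split=> //.
  by move=> _ [q [y [Tq /h/iA[_ hq] ->]]]; rewrite comp_meval rsegreE hq.
move=> y Sy; apply/iA; split; first by apply: segre_neq0 => //; apply: S0.
by move=> q Tq; rewrite -rsegreE -comp_meval; apply: h; exists q, y.
Qed.

Variables (X : variety N) (Y : variety M).

Definition prod_points (z : 'rV[k]_(N * M)) : Prop :=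
  exists x y, [/\ X x, Y y & z = segre x y].

Fact prod_locally_closed : locally_closed prod_points.
Proof.
have [A [B [cA cB iX]]] := variety_locally_closed X.
have [C [D [cC cD iY]]] := variety_locally_closed Y.
have A0 x : A x -> x <> 0 by have [T [_ iT]] := cA; move=> /iT[].
have C0 x : C x -> x <> 0 by have [T [_ iT]] := cC; move=> /iT[].
have [E [cE iE]] := segre_union_closed cB cD.
eexists _, E; split; [exact: (segre_closed cA cC)|exact: cE|].
move=> z; split.
  move=> [x [y [/iX[Ax nBx] /iY[Cy nDy] ->]]]; split; first by exists x, y.
  by move/(iE _ _ (A0 _ Ax) (C0 _ Cy)); case.
move=> [[x [y [Ax Cy ->]]] nE]; exists x, y; split=> //.
  by apply/iX; split=> // Bx; apply: nE; apply/iE; [apply: A0|apply: C0|left].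
by apply/iY; split=> // Dy; apply: nE; apply/iE; [apply: A0|apply: C0|right].
Qed.

Fact prod_irreducible : irreducible prod_points.
Proof.
have [[x0 Xx0] irrX] := variety_irreducible X.
have [[y0 Yy0] irrY] := variety_irreducible Y.
split; first by exists (segre x0 y0), x0, y0.
move=> A B cA cB hAB.
have Y0 y : Y y -> y <> 0 by apply: variety_neq0.
have X0 x : X x -> x <> 0 by apply: variety_neq0.
have S0 (x : 'rV[k]_N) (x' : 'rV_N) : X x -> x' = x -> x' <> 0.
  by move=> /X0 ? ->.
have [x Xx|h|h] := irrX _ _ (rfiber_closed cA Y0) (rfiber_closed cB Y0).
- have [y Yy|h|h] := irrY _ _ (lfiber_closed cA (S0 x ^~ Xx))
    (lfiber_closed cB (S0 x ^~ Xx)).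
  + have [h|h] := hAB (segre x y) (ex_intro _ x (ex_intro _ y (And3 Xx Yy erefl))).
      by left; split; [apply: Y0|move=> _ ->].
    by right; split; [apply: Y0|move=> _ ->].
  + by left; split; [apply: X0|move=> y /h[_]; apply].
  + by right; split; [apply: X0|move=> y /h[_]; apply].
- by left=> _ [x [y [/h[_ hx] Yy ->]]]; apply: hx.
- by right=> _ [x [y [/h[_ hx] Yy ->]]]; apply: hx.
Qed.

Definition prod_variety : variety (N * M) :=
  Variety prod_locally_closed prod_irreducible.

End Segre.

Lemma coord_subproof N (X : variety N) : exists a, ~ vanishes X 'X_a.
Proof.
have [[x Xx] _] := variety_irreducible X.
have [a ha] := row_neq0 (variety_neq0 Xx).
by exists a => /(_ x Xx)/eqP; rewrite mevalXU (negPf ha).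
Qed.

Definition coord N (X : variety N) : 'I_N := projT1 (cid (coord_subproof X)).

Lemma coordP N (X : variety N) : ~ vanishes X 'X_(coord X).
Proof. by rewrite /coord; case: cid. Qed.

Section ProductMap.
Variables (N M N' M' : nat).
Variables (X : variety N) (Y : variety M) (X' : variety N') (Y' : variety M').
Variables (f : ratmap X X') (g : ratmap Y Y').

(* In the Segre coordinates z_(i,j) = x_i y_j, the forms
   f_i(z_(.,b)) g_j(z_(a,.)) represent segre (f x) (g y) at segre x y whenever
   x_a and y_b are nonzero (see prod_formE). *)
Definition prod_form : (N' * M').-tuple {mpoly k[N * M]} :=
  [tuple mxvec (\matrix_(i < N', j < M')
     ((tnth f i \mPo zcol N (coord Y)) * (tnth g j \mPo zrow M (coord X)))) 0 l
   | l < N' * M'].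

Lemma prod_formE (x : 'rV[k]_N) (y : 'rV[k]_M) :
  map_at prod_form (segre x y) =
  (y 0 (coord Y) ^+ ratmap_deg f * x 0 (coord X) ^+ ratmap_deg g)
    *: segre (map_at f x) (map_at g y).
Proof.
apply/rowP => l; case/mxvec_indexP: l => i j.
rewrite [LHS]mxE tnth_mktuple mxvecE mxE mevalM [RHS]mxE segreE.
rewrite (comp_zcolE _ _ _ (ratmap_homog f i)).
rewrite (comp_zrowE _ _ _ (ratmap_homog g j)).
by rewrite [map_at f x 0 i]mxE [map_at g y 0 j]mxE mulrACA.
Qed.

Fact prod_form_homog l :
  tnth prod_form l \is (ratmap_deg f + ratmap_deg g).-homog.
Proof.
rewrite tnth_mktuple; case/mxvec_indexP: l => i j; rewrite mxvecE mxE.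
by apply: dhomogM; [apply: comp_zcol_homog|apply: comp_zrow_homog];
  apply: ratmap_homog.
Qed.

Lemma prod_form_in (x : 'rV[k]_N) (y : 'rV[k]_M) :
  x 0 (coord X) != 0 -> y 0 (coord Y) != 0 ->
  X' (map_at f x) -> Y' (map_at g y) ->
  prod_variety X' Y' (map_at prod_form (segre x y)).
Proof.
move=> xa yb hf hg; rewrite prod_formE; apply/variety_scale.
  by rewrite mulf_neq0 ?expf_neq0.
by exists (map_at f x), (map_at g y).
Qed.

Fact prod_form_generic : exists B, [/\ proj_closed B,
  exists z, prod_variety X Y z /\ ~ B z &
  forall z, prod_variety X Y z -> ~ B z ->
    prod_variety X' Y' (map_at prod_form z)].
Proof.
have [B [cB [x0 [Xx0 nBx0]] hB]] := ratmap_generic f.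
have [D [cD [y0 [Yy0 nDy0]] hD]] := ratmap_generic g.
have [d [q [hq qx0 hqB]]] := closed_form cB (variety_neq0 Xx0) nBx0.
have [e [r [hr ry0 hrD]]] := closed_form cD (variety_neq0 Yy0) nDy0.
have [E [cE iE]] := segre_union_closed
  (form_zeros_closed (dhomogM hq (X_homog (coord X))))
  (form_zeros_closed (dhomogM hr (X_homog (coord Y)))).
exists E; split=> //.
  have /existsNP[x /not_implyP[Xx hx]] : ~ vanishes X (q * 'X_(coord X)).
    case/(vanishesM hq (X_homog _)) => [/(_ x0 Xx0)/eqP|/coordP //].
    by rewrite (negPf qx0).
  have /existsNP[y /not_implyP[Yy hy]] : ~ vanishes Y (r * 'X_(coord Y)).
    case/(vanishesM hr (X_homog _)) => [/(_ y0 Yy0)/eqP|/coordP //].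
    by rewrite (negPf ry0).
  exists (segre x y); split; first by exists x, y.
  case/(iE x y (variety_neq0 Xx) (variety_neq0 Yy)) => -[_ h].
    exact: hx (h _ erefl).
  exact: hy (h _ erefl).
move=> _ [x [y [Xx Yy ->]]] nE.
have x1 := variety_neq0 Xx; have y1 := variety_neq0 Yy.
have : (q * 'X_(coord X)).@[x 0] != 0.
  by apply/eqP => h; apply: nE; apply/iE => //; left; split=> // p ->.
rewrite mevalM mevalXU mulf_eq0 => /norP[qx xa].
have : (r * 'X_(coord Y)).@[y 0] != 0.
  by apply/eqP => h; apply: nE; apply/iE => //; right; split=> // p ->.
rewrite mevalM mevalXU mulf_eq0 => /norP[ry yb].
apply: prod_form_in => //.
  by apply: hB => // /hqB/eqP; rewrite (negPf qx).
by apply: hD => // /hrD/eqP; rewrite (negPf ry).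
Qed.

Definition prod_map : ratmap (prod_variety X Y) (prod_variety X' Y') :=
  RatMap prod_form_homog prod_form_generic.

Lemma prod_map_dominant : dominant f -> dominant g -> dominant prod_map.
Proof.
move=> df dg A cA hA _ [x' [y' [Xx' Yy' ->]]].
have Y0 := @variety_neq0 _ Y'; have X0 := @variety_neq0 _ X'.
have S0 (x : 'rV[k]_N') : x = x' -> x <> 0 by move=> ->; apply: X0 Xx'.
have [_] : y' <> 0 /\ forall x, x = x' -> A (segre x y'); last exact.
apply: (dominant_open dg (lfiber_closed cA S0) (X_homog (coord Y))
  (@coordP _ Y)) => // y Yy; rewrite mevalXU => /eqP yb Ygy.
split=> [|_ ->]; first exact: Y0 Ygy.
have S1 (v : 'rV[k]_M') : v = map_at g y -> v <> 0 by move=> ->; apply: Y0 Ygy.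
have [_] : x' <> 0 /\ forall v, v = map_at g y -> A (segre x' v); last exact.
apply: (dominant_open df (rfiber_closed cA S1) (X_homog (coord X))
  (@coordP _ X)) => // x Xx; rewrite mevalXU => /eqP xa Xfx.
split=> [|_ ->]; first exact: X0 Xfx.
have := hA (segre x y) (ex_intro _ x (ex_intro _ y (And3 Xx Yy erefl)))
  (prod_form_in xa yb Xfx Ygy).
rewrite prod_formE closed_scale //.
by rewrite mulf_neq0 ?expf_neq0.
Qed.

End ProductMap.
End Products.

Section Dynamics.

(* A rational dynamical system (X, phi), X in P^(N-1). *)
Record rds (N : nat) := RDS {
  rds_var :> variety N;
  rds_map : ratmap rds_var rds_var;
  rds_dominant : dominant rds_map }.

Definition prod_rds N M (X : rds N) (Y : rds M) : rds (N * M) :=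
  RDS (prod_map_dominant (@rds_dominant _ X) (@rds_dominant _ Y)).

Definition Fix N (X : rds N) (f : ratfun X) : Prop :=
  pullback (@rds_dominant _ X) f = f.

End Dynamics.

Section Dimensions.

Definition is_max (d : Order.disp_t) (T : porderType d) (P : T -> Prop) (m : T) :
  Prop := P m /\ forall n, P n -> (n <= m)%O.

Definition alg_indep (K : fieldType) (iota : {rmorphism k -> K}) (r : nat)
    (f : 'I_r -> K) : Prop :=
  forall p : {mpoly k[r]}, mmap iota f p = 0 -> p = 0.

(* is_trdeg iota S d: the subextension S of iota : k -> K has transcendence
   degree d over k. *)
Definition is_trdeg (K : fieldType) (iota : {rmorphism k -> K})
    (S : K -> Prop) (d : nat) : Prop :=
  is_max (fun r : nat =>
    exists f : 'I_r -> K, (forall i, S (f i)) /\ alg_indep iota f) d.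

(* The dimension of an irreducible variety is the transcendence degree over k
   of its function field. *)
Definition is_dim N (X : variety N) (d : nat) : Prop :=
  is_trdeg (@ratfun_const _ X) (fun _ => True) d.

Definition is_adim N (X : rds N) (d : nat) : Prop :=
  is_trdeg (@ratfun_const _ X) (@Fix _ X) d.

Definition is_sadim N (X : rds N) (s : int) : Prop :=
  is_max (fun e : int => exists M (Y : rds M) (a b : nat),
    [/\ is_adim (prod_rds X Y) a, is_adim Y b & e = a%:Z - b%:Z]) s.

End Dimensions.
End Varieties.

(* Main.v *)
(* The fixed elements of L = k(X x Y) and the subfield K = k(Y) are linearly
   disjoint over the fixed field of K (Artin), so elements of Fix(L) that are
   algebraically independent over Fix(K) remain so over K. As L is algebraic
   over K(x_1, ..., x_d), where x_1, ..., x_d is a transcendence basis of k(X),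
   there are at most d = dim X of them by Steinitz exchange, whence
   adim(X x Y) <= adim(Y) + d. *)
From HB Require Import structures.
From mathcomp Require Import all_boot all_order all_algebra.
From mathcomp Require Import generic_quotient.
From mathcomp Require Import ring zify mpoly boolp.
Require Import Defs.

Set Implicit Arguments.
Unset Strict Implicit.
Unset Printing Implicit Defensive.
Import Order.TTheory GRing.Theory Num.Theory.
Local Open Scope ring_scope.
Local Open Scope quotient_scope.

(** * Subfields generated by a subset *)

Section GeneratedSubfield.
Variable L : fieldType.
Implicit Types (B C : L -> Prop) (x y : L).

Inductive generated B : L -> Prop :=
  | generated_base x : B x -> generated B x
  | generated1 : generated B 1
  | generatedB x y : generated B x -> generated B y -> generated B (x - y)
  | generated_div x y : generated B x -> generated B y -> generated B (x / y).

Definition gen B : {pred L} := fun x => `[< generated B x >].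

Lemma genP B x : reflect (generated B x) (x \in gen B).
Proof. exact: asboolP. Qed.

Fact gen_divring_closed B : divring_closed (gen B).
Proof.
split=> [|x y /genP gx /genP gy|x y /genP gx /genP gy]; apply/genP.
- exact: generated1.
- exact: generatedB.
- exact: generated_div.
Qed.

HB.instance Definition _ B :=
  GRing.isDivringClosed.Build L (gen B) (gen_divring_closed B).

Lemma gen_base B x : B x -> x \in gen B.
Proof. by move=> Bx; apply/genP/generated_base. Qed.

Lemma gen_sub (S : divringClosed L) B :
  (forall x, B x -> x \in S) -> {subset gen B <= S}.
Proof.
move=> BS x /genP; elim=> {x} [x /BS //||x y _ Sx _ Sy|x y _ Sx _ Sy].
- exact: rpred1.
- exact: rpredB.
- exact: rpred_div.
Qed.

Lemma gen_mono B C : (forall x, B x -> C x) -> {subset gen B <= gen C}.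
Proof. by move=> BC; apply: gen_sub => x /BC; apply: gen_base. Qed.

(** Packaged as a type so that it carries a field structure and the theory of [algebraicOver] along
    its inclusion into [L] applies. *)
Record subfield_gen B := SubfieldGen {
  subfield_gen_val :> L; _ : subfield_gen_val \in gen B }.

End GeneratedSubfield.

Section SubfieldInstances.
Variables (L : fieldType) (B : L -> Prop).
HB.instance Definition _ := [isSub for @subfield_gen_val L B].
HB.instance Definition _ := [Choice of subfield_gen B by <:].
HB.instance Definition _ :=
  [SubChoice_isSubComUnitRing of subfield_gen B by <:].
HB.instance Definition _ :=
  [SubComUnitRing_isSubIntegralDomain of subfield_gen B by <:].
HB.instance Definition _ :=
  [SubIntegralDomain_isSubField of subfield_gen B by <:].
End SubfieldInstances.

(** * Relative algebraic closure *)

Section AlgebraicClosure.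
Variable L : fieldType.
Implicit Types (B C : L -> Prop) (x y : L) (s t : seq L).

(** The polynomial lives over [L] and only its coefficients are confined to [gen B], so that
    enlarging [B] is a mere inclusion of coefficient sets. *)
Definition cl B x : Prop :=
  exists p, [/\ p != 0, p \is a polyOver (gen B) & root p x].

Lemma cl_mono B C x : (forall z, B z -> C z) -> cl B x -> cl C x.
Proof.
move=> BC [p [p0 pB px]]; exists p; split=> //.
exact: (polyOverS (gen_mono BC)).
Qed.

Lemma cl_algebraic B x :
  cl B x <-> algebraicOver (val : {rmorphism subfield_gen B -> L}) x.
Proof.
split=> [[p [p0 /polyOverP pB px]]|[q q0 qx]]; last first.
  exists (map_poly (val : {rmorphism subfield_gen B -> L}) q).
  split=> //; first by rewrite map_poly_eq0.
  by apply/polyOverP => i; rewrite coef_map; apply: (valP q`_i).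
pose q := \poly_(i < size p) (SubfieldGen (pB i)).
have qE : map_poly (val : {rmorphism subfield_gen B -> L}) q = p.
  apply/polyP => i; rewrite coef_map coef_poly.
  by case: ltnP => //= ?; rewrite nth_default.
exists q; last by rewrite qE.
by rewrite -(map_poly_eq0 (val : {rmorphism subfield_gen B -> L})) qE.
Qed.

Definition clp B : {pred L} := fun x => `[< cl B x >].

Fact clp_divring_closed B : divring_closed (clp B).
Proof.
split=> [|x y|x y]; first by apply/asboolP/cl_algebraic/algebraic1.
  move=> /asboolP/cl_algebraic ax /asboolP/cl_algebraic ay.
  exact/asboolP/cl_algebraic/algebraic_sub.
move=> /asboolP/cl_algebraic ax /asboolP/cl_algebraic ay.
exact/asboolP/cl_algebraic/algebraic_div.
Qed.

HB.instance Definition _ B :=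
  GRing.isDivringClosed.Build L (clp B) (clp_divring_closed B).

Lemma cl_base B x : B x -> cl B x.
Proof.
move=> Bx; exists ('X - x%:P); rewrite polyXsubC_eq0 root_XsubC eqxx.
by rewrite polyOverXsubC gen_base.
Qed.

Lemma cl_gen B C x : (forall z, C z -> cl B z) -> x \in gen C -> cl B x.
Proof.
move=> CB xC; apply/asboolP.
by apply: (@gen_sub _ (clp B) C) xC => z /CB ?; apply/asboolP.
Qed.

(** Algebraic and integral agree over a field, and integrality passes from the coefficients of a
    nonzero polynomial to its roots. *)
Lemma cl_trans B C x : (forall z, C z -> cl B z) -> cl C x -> cl B x.
Proof.
move=> CB [p [p0 /polyOverP pC px]].
apply/cl_algebraic/integral_algebraic/(integral_root p0 px).
apply/integral_poly => i; apply/integral_algebraic/cl_algebraic.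
exact: cl_gen (pC i).
Qed.

End AlgebraicClosure.

(** * Clearing denominators *)

Section CommonDenominator.
Variables (L : fieldType) (A : comNzRingType) (phi : {rmorphism A -> L}).
Variables (S : subringClosed A) (B : L -> Prop).
Hypothesis B_im : forall x, B x -> exists2 a, a \in S & phi a = x.

Lemma gen_fraction x : x \in gen B ->
  exists a b, [/\ a \in S, b \in S, phi b != 0 & phi b * x = phi a].
Proof.
move=> /genP; elim=> {x} [x /B_im[a Sa <-]||x y _ [a [b [Sa Sb b0 ax]]]
    _ [c [d [Sc Sd d0 cy]]]|x y _ [a [b [Sa Sb b0 ax]]]
    _ [c [d [Sc Sd d0 cy]]]].
- by exists a, 1; rewrite rpred1 rmorph1 oner_eq0 mul1r.
- by exists 1, 1; rewrite rpred1 rmorph1 oner_eq0 mul1r.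
- exists (a * d - c * b), (b * d); split; rewrite ?(rpredB, rpredM) //.
    by rewrite rmorphM mulf_neq0.
  by rewrite rmorphB !rmorphM -ax -cy; ring.
(* Division by zero gives [0], which is represented by the fraction [0 / 1]. *)
have [y0|y0] := eqVneq y 0.
  exists 0, 1; rewrite rpred0 rpred1 rmorph1 rmorph0 oner_eq0.
  by rewrite y0 invr0 !mulr0.
exists (a * d), (b * c); split; rewrite ?rpredM // !rmorphM -?ax -cy.
  by rewrite !mulf_neq0.
by field.
Qed.

(** Serves to replace adjoined elements by variables: with [A] a polynomial ring and [phi] an
    evaluation, [Q] lifts [P], up to a nonzero scalar, to a polynomial in more variables. *)
Lemma gen_common_denominator (P : {poly L}) : P \is a polyOver (gen B) ->
  exists c (Q : {poly A}), [/\ c \in S, phi c != 0, Q \is a polyOver S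
    & map_poly phi Q = phi c *: P].
Proof.
elim/poly_ind: P => [_|P a IH /polyOverP PB].
  by exists 1, 0; rewrite rpred1 rmorph1 oner_eq0 rpred0 rmorph0 scaler0.
have [|c [Q [Sc c0 SQ QE]]] := IH.
  apply/polyOverP => i; have := PB i.+1.
  by rewrite coefD coefMX coefC addr0.
have [|u [v [Su Sv v0 uE]]] := @gen_fraction a.
  by have := PB 0; rewrite coefD coefMX coefC add0r.
exists (c * v), (v%:P * Q * 'X + (c * u)%:P); split; rewrite ?rpredM //.
- by rewrite rmorphM mulf_neq0.
- by rewrite rpredD ?rpredM ?polyOverX ?polyOverC ?rpredM.
rewrite rmorphD !rmorphM /= map_polyX !map_polyC QE /= -uE.
rewrite -!mul_polyC !polyCM; ring.
Qed.

End CommonDenominator.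

(** * Steinitz exchange *)

Section Exchange.
Variable L : fieldType.
Implicit Types (B C : L -> Prop) (x y : L) (s t : seq L).

Definition adj B s : L -> Prop := fun z => B z \/ z \in s.

(** Clearing denominators turns the relation for [x] into a two-variable polynomial [Q] over
    [gen B], whose inner variable stands for [y] and outer one for [x]. Substituting [x] alone then
    leaves a relation for [y]. *)
Lemma cl_exchange B x y :
  cl (adj B [:: y]) x -> ~ cl B x -> cl (adj B [:: x]) y.
Proof.
move=> [P [P0 PB Px]] nx.
have im z : adj B [:: y] z ->
    exists2 a, a \in polyOver (gen B) & horner_eval y a = z.
  case=> [Bz|].
    by exists z%:P; rewrite ?polyOverC ?gen_base /horner_eval ?hornerC.
  by rewrite inE => /eqP->; exists 'X; rewrite ?polyOverX /horner_eval ?hornerX.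
have [c [Q [_ c0 QB QE]]] := gen_common_denominator im PB.
have Q0 : Q != 0.
  by apply: contraNneq P0 => Q0; move/eqP: QE;
    rewrite Q0 rmorph0 eq_sym scaler_eq0 (negPf c0).
have [R0|R0] := eqVneq Q.[x%:P] 0.
  (* [Q] vanishes identically at [x], so each of its coefficients along the inner variable, a
     polynomial over [gen B], has [x] as a root; the leading one is nonzero. *)
  case: nx; exists (lead_coef (swapXY Q)).
  rewrite lead_coef_eq0 swapXY_eq0; split=> //.
    apply/polyOverP => i; rewrite lead_coefE coef_swapXY.
    by move/polyOverP: QB => /(_ i)/polyOverP.
  move: R0; rewrite horner_polyC => /polyP/(_ (size (swapXY Q)).-1).
  by rewrite coef_map coef0 => /eqP.
exists Q.[x%:P]; split=> //.
  apply: rpred_horner; last first.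
    by rewrite polyOverC gen_base //; right; rewrite inE.
  apply: polyOverS QB => q; apply: polyOverS.
  by apply: gen_mono; left.
rewrite rootE -horner2_swapXY horner_polyC swapXYK QE hornerZ.
by rewrite (rootP Px) mulr0.
Qed.

(** This sequential form suits exchange arguments; [mindepP] equates it with algebraic
    independence. *)
Fixpoint indep B s : Prop :=
  if s is x :: s' then ~ cl B x /\ indep (adj B [:: x]) s' else True.

Lemma adj_nil B : adj B [::] = B.
Proof. by apply/funext => z; apply/propext; split=> [[]//|]; left. Qed.

Lemma adj_cat B s t : adj (adj B s) t = adj B (s ++ t).
Proof.
apply/funext => z; apply/propext; rewrite /adj mem_cat.
by split=> [[[]|]|[|/orP[]]] ?; rewrite ?orbT; auto; right; apply/orP; auto.
Qed.

Lemma adj_eq B s t : s =i t -> adj B s = adj B t.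
Proof. by move=> st; apply/funext => z; rewrite /adj st. Qed.

Lemma cl_adj B C s x : (forall z, B z -> cl C z) ->
  cl (adj B s) x -> cl (adj C s) x.
Proof.
move=> BC; apply: cl_trans => z [/BC|zs]; last by apply: cl_base; right.
by apply: cl_mono; left.
Qed.

Lemma indep_cl B C s : (forall z, C z -> cl B z) -> indep B s -> indep C s.
Proof.
elim: s B C => //= x s IH B C CB [nx hs]; split.
  by move=> /(cl_trans CB).
apply: IH hs => z [/CB|]; first by apply: cl_mono; left.
by move=> zx; apply: cl_base; right.
Qed.

Lemma indep_rcons B s x :
  indep B (rcons s x) <-> indep B s /\ ~ cl (adj B s) x.
Proof.
elim: s B => [|y s IH] B /=; first by rewrite adj_nil; tauto.
by rewrite IH adj_cat /=; tauto.
Qed.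

(** [y] is the first entry of [t] whose adjunction makes [x] algebraic; [cl_exchange] is applied
    over [B] and [t1]. *)
Lemma exchange_split B t x : ~ cl B x -> cl (adj B t) x ->
  exists t1 y t2, t = t1 ++ y :: t2 /\ cl (adj B (x :: t1)) y.
Proof.
elim: t B => [|y t IH] B nx; first by rewrite adj_nil.
move=> xt; have [xy|nxy] := pselect (cl (adj B [:: y]) x).
  by exists [::], y, t; split=> //; apply: cl_exchange.
have [|t1 [z [t2 [-> zt]]]] := IH (adj B [:: y]) nxy; first by rewrite adj_cat.
exists (y :: t1), z, t2; split=> //; move: zt; rewrite adj_cat.
by rewrite (@adj_eq _ _ (x :: y :: t1)) // => w; rewrite !inE orbCA.
Qed.

Lemma steinitz B s t : indep B s -> (forall x, x \in s -> cl (adj B t) x) ->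
  (size s <= size t)%N.
Proof.
elim: s B t => //= x s IH B t [nx hs] st.
have [|t1 [y [t2 [tE yt]]]] := exchange_split nx (st x _).
  by rewrite inE eqxx.
rewrite tE size_cat /= addnS ltnS -size_cat.
apply: IH hs _ => z zs.
have := st z; rewrite inE zs orbT => /(_ isT); apply: cl_trans => w.
rewrite adj_cat /=.
case=> [Bw|]; first by apply: cl_base; left.
rewrite tE mem_cat inE orbCA => /orP[/eqP->|wt].
  apply: cl_mono yt => v [vB|vt]; [by left|right].
  by move: vt; rewrite !inE mem_cat => /orP[->|->]; rewrite ?orbT.
by apply: cl_base; right; rewrite inE mem_cat wt orbT.
Qed.

(** Greedy choice: an entry is kept exactly when it is transcendental over the base and the entries
    kept so far. *)
Lemma indep_extend B s : exists t,
  [/\ {subset t <= s}, indep B t & forall x, x \in s -> cl (adj B t) x].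
Proof.
elim: s B => [|x s IH] B; first by exists [::].
have [Bx|nx] := pselect (cl B x).
  have [t [ts it st]] := IH B; exists t; split=> // z.
    by move/ts; rewrite inE orbC => ->.
  rewrite inE => /predU1P[->|/st//]; by apply: cl_mono Bx; left.
have [t [ts it st]] := IH (adj B [:: x]); exists (x :: t); split=> // z.
  by rewrite !inE => /predU1P[->|/ts->]; rewrite ?eqxx ?orbT.
rewrite inE => /predU1P[->|/st]; last by rewrite adj_cat.
by apply: cl_base; right; rewrite inE eqxx.
Qed.

End Exchange.

(** * Multivariate polynomials as univariate polynomials in the last variable *)

Section LastVariable.
Variables (R : comNzRingType) (n : nat).
Implicit Types (p : {mpoly R[n.+1]}) (q : {mpoly R[n]}).

(** The inverse of [muni]. *)
Definition mlast_poly (Q : {poly {mpoly R[n]}}) : {mpoly R[n.+1]} :=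
  (map_poly (@mwiden n R) Q).['X_ord_max].

Lemma muniK : cancel (@muni n R) mlast_poly.
Proof.
move=> p; rewrite muniE /mlast_poly rmorph_sum horner_sum [RHS]mpolyE.
apply: eq_bigr => m _.
rewrite /= map_polyZ map_polyXn /= hornerZ hornerXn mwidenZ mwidenX.
rewrite -scalerAl.
congr (_ *: _); rewrite mpolyXn -mpolyXD; congr 'X_[_].
apply/mnmP => i; rewrite mnmDE mulmnE mnm1E.
have [<-|i_max] := eqVneq ord_max i.
  by rewrite mnmwiden_ordmax add0n mul1n.
rewrite mul0n addn0.
have [j ->] : exists j : 'I_n, i = widen_ord (leqnSn n) j.
  have i_lt : (i < n)%N.
    by rewrite ltn_neqAle -ltnS ltn_ord andbT; apply: contraNneq i_max => ij;
       apply/eqP/val_inj.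
  by exists (Ordinal i_lt); apply/val_inj.
by rewrite mnmwiden_widen mnmE.
Qed.

Lemma mwiden_supp q :
  mwiden q = \sum_(m <- msupp q) q@_m *: 'X_[mnmwiden m].
Proof.
rewrite {1}(mpolyE q) (raddf_sum (@mwiden n R)).
by apply: eq_bigr => m _; rewrite /= mwidenZ mwidenX.
Qed.

Lemma muni_widen q : muni (mwiden q) = q%:P.
Proof.
rewrite mwiden_supp (raddf_sum (@muni n R)) [in RHS](mpolyE q).
rewrite (raddf_sum (@polyC {mpoly R[n]})).
apply: eq_bigr => m _; rewrite /= muniZ -mul_mpolyC polyCM.
rewrite mul_polyC; congr (_ *: _); rewrite muniE msuppX big_seq1 mcoeffX eqxx.
rewrite scale1r mnmwiden_ordmax expr0 alg_polyC; congr 'X_[_]%:P.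
by apply/mnmP => i; rewrite mnmE mnmwiden_widen.
Qed.

Lemma muni_last : muni ('X_ord_max : {mpoly R[n.+1]}) = 'X.
Proof.
rewrite muniE msuppX big_seq1 mcoeffX eqxx scale1r mnm1E eqxx expr1.
rewrite (_ : [multinom _ | _ < _] = 0%MM) ?mpolyX0 ?scale1r //.
apply/mnmP => i; rewrite mnmE mnm1E mnm0E; case: eqP => // /(congr1 val) /= ni.
by have := ltn_ord i; rewrite -ni ltnn.
Qed.

Lemma mlast_polyK : cancel mlast_poly (@muni n R).
Proof.
elim/poly_ind=> [|Q c IH].
  by rewrite /mlast_poly !rmorph0 horner0 rmorph0.
rewrite -[in RHS]IH -[in RHS]muni_widen -[in RHS]muni_last -muniM -muniD.
congr muni.
rewrite {1}/mlast_poly rmorphD rmorphM /= map_polyX map_polyC /=.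
by rewrite hornerD hornerMX hornerC.
Qed.

Lemma meval_widen (v : 'I_n.+1 -> R) q :
  (mwiden q).@[v] = q.@[fun i => v (widen_ord (leqnSn n) i)].
Proof.
rewrite mwiden_supp (raddf_sum (meval v)) [RHS]mevalE; apply: eq_bigr => m _ /=.
rewrite mevalZ mevalX big_ord_recr /= mnmwiden_ordmax expr0.
by rewrite mulr1; congr (_ * _); apply: eq_bigr => i _; rewrite mnmwiden_widen.
Qed.

Lemma meval_mlast (v : 'I_n.+1 -> R) Q :
  (mlast_poly Q).@[v] =
  (map_poly (meval (fun i => v (widen_ord (leqnSn n) i))) Q).[v ord_max].
Proof.
rewrite /mlast_poly; elim/poly_ind: Q => [|Q c IH].
  by rewrite !rmorph0 !horner0 rmorph0.
rewrite !rmorphD !rmorphM /= !map_polyX !map_polyC /= !hornerMXaddC.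
by rewrite mevalD mevalM mevalXU meval_widen IH.
Qed.

Lemma mlast_polyOver (S : semiringClosed R) Q :
  Q \is a polyOver (mpolyOver n S) -> mlast_poly Q \is a mpolyOver n.+1 S.
Proof.
move=> /polyOverP QS; apply: rpred_horner; last exact: mpolyOverX.
apply/polyOverP => i; rewrite coef_map /=.
rewrite mwiden_supp rpred_sum // => m _.
rewrite mpolyOverZ ?mpolyOverX //.
exact: (mpolyOverP _ (QS i)).
Qed.

Lemma muni_polyOver (S : semiringClosed R) p :
  p \is a mpolyOver n.+1 S -> muni p \is a polyOver (mpolyOver n S).
Proof.
move=> /mpolyOverP pS; apply/polyOverP => i; rewrite muniE coef_sum.
apply: rpred_sum => m _; rewrite coefZ coefXn mulr_natr rpredMn //.
by rewrite mpolyOverZ ?mpolyOverX.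
Qed.

End LastVariable.

(** * Algebraic independence *)

Section AlgebraicIndependence.
Variable L : fieldType.
Implicit Types (B C : L -> Prop) (f : nat -> L).

(** [f] is indexed by [nat] rather than ['I_n] so that an induction on [n] keeps the same [f]. *)
Definition mindep B n f : Prop :=
  forall p : {mpoly L[n]}, p \is a mpolyOver n (gen B) ->
    p.@[fun i => f i] = 0 -> p = 0.

Lemma mindep0 B f : mindep B 0 f.
Proof.
move=> p _; rewrite (_ : p = (p@_0)%:MP) ?mevalC => [->|]; first exact: mpolyC0.
by apply/mpolyP => m; rewrite mcoeffC (_ : m = 0%MM) ?eqxx ?mulr1 //;
  apply/mnmP => -[].
Qed.

Lemma cl_mkseq B n f x : cl (adj B (mkseq f n)) x ->
  exists Q : {poly {mpoly L[n]}}, [/\ Q \is a polyOver (mpolyOver n (gen B)),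
    map_poly (meval (fun i : 'I_n => f i)) Q != 0 &
    (map_poly (meval (fun i : 'I_n => f i)) Q).[x] = 0].
Proof.
move=> [P [P0 PB Px]].
have im z : adj B (mkseq f n) z ->
    exists2 a, a \in mpolyOver n (gen B) & meval (fun i : 'I_n => f i) a = z.
  case=> [Bz|]; first by exists z%:MP; rewrite ?mpolyOverC ?gen_base ?mevalC.
  case/mapP=> i; rewrite mem_iota /= add0n => i_lt ->.
  by exists 'X_(Ordinal i_lt); rewrite ?mpolyOverX ?mevalXU.
have [c [Q [_ c0 QB QE]]] := gen_common_denominator im PB.
exists Q; split=> //; rewrite QE ?scaler_eq0 ?negb_or ?c0 //.
by rewrite hornerZ (rootP Px) mulr0.
Qed.

(** Specialising the first [n] variables in [muni p] leaves a univariate polynomial. If it is zero,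
    independence of the first [n] values kills every coefficient; otherwise it makes [f n] algebraic
    over [B] and those values. The converse lifts an algebraic relation for [f n] by [cl_mkseq]. *)
Lemma mindepP B n f : mindep B n f <-> indep B (mkseq f n).
Proof.
elim: n => [|n IH]; first by split=> // _; apply: mindep0.
rewrite mkseqS indep_rcons -IH; split=> [h|[hn nx] p pB pf].
  split=> [p pB pf|/cl_mkseq[Q [QB Q0 Qx]]].
    have : mlast_poly p%:P = 0.
      apply: h; first by apply: mlast_polyOver; rewrite polyOverC.
      by rewrite meval_mlast map_polyC hornerC.
    move/(congr1 (@muni _ _)); rewrite mlast_polyK rmorph0 => /eqP.
    by rewrite polyC_eq0 => /eqP.
  have : mlast_poly Q = 0.
    by apply: h; [apply: mlast_polyOver|rewrite meval_mlast].
  move/(congr1 (@muni _ _)); rewrite mlast_polyK rmorph0 => Q00.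
  by rewrite Q00 rmorph0 eqxx in Q0.
have {}pB := muni_polyOver pB.
rewrite -(muniK p) in pf *; move: pf; rewrite meval_mlast.
set P := map_poly _ _ => /= Px.
have [P0|P0] := eqVneq P 0.
  rewrite (_ : muni p = 0) ?/mlast_poly ?rmorph0 ?horner0 //.
  apply/polyP => i; rewrite coef0; apply: hn; first exact: (polyOverP pB).
  by have /polyP/(_ i) := P0; rewrite coef_map coef0.
case: nx; exists P; split; rewrite ?rootE ?Px //.
apply/polyOverP => i; rewrite coef_map /=; apply: rpred_mhorner.
  apply: mpolyOverS; last exact: (polyOverP pB).
  by apply: gen_mono; left.
apply/forallP => j; apply: gen_base; right; apply/mapP; exists (val j) => //.
by rewrite mem_iota add0n ltn_ord.
Qed.

End AlgebraicIndependence.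

(** * Change of coefficients and evaluation *)

Section MapEval.
Variables (R S : comNzRingType) (h : {rmorphism R -> S}) (n : nat).
Implicit Types p : {mpoly R[n]}.

Lemma mmap_meval (v : 'I_n -> S) p : mmap h v p = (map_mpoly h p).@[v].
Proof.
rewrite [in RHS](mpolyE p) (raddf_sum (map_mpoly h)) (raddf_sum (meval v)).
apply: eq_bigr => m _ /=.
by rewrite map_mpolyZ map_mpolyX mevalZ mevalX.
Qed.

Lemma meval_map_mpoly (v : 'I_n -> R) p :
  (map_mpoly h p).@[fun i => h (v i)] = h p.@[v].
Proof.
rewrite -mmap_meval mevalE rmorph_sum; apply: eq_bigr => m _ /=.
rewrite rmorphM rmorph_prod.
by congr (_ * _); apply: eq_bigr => i _; rewrite rmorphXn.
Qed.

End MapEval.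

(** * Independence over a stable subfield and over its fixed elements *)

Section FixedField.
Variables (L : fieldType) (sigma : {rmorphism L -> L}) (B : L -> Prop).
Hypothesis sigma_B : forall x, B x -> sigma x \in gen B.

Lemma sigma_gen x : x \in gen B -> sigma x \in gen B.
Proof.
move=> /genP; elim=> {x} [x /sigma_B //||x y _ sx _ sy|x y _ sx _ sy].
- by rewrite rmorph1 rpred1.
- by rewrite rmorphB rpredB.
- by rewrite fmorph_div rpred_div.
Qed.

(* Artin's argument: subtract from a relation with a minimal number of
   monomials, normalized to have a coefficient 1, its image under sigma. *)
Lemma mindep_fixed n (f : nat -> L) :
  (forall i, (i < n)%N -> sigma (f i) = f i) ->
  mindep (fun x => x \in gen B /\ sigma x = x) n f -> mindep B n f.
Proof.
move=> ff hf p; have [r] := ubnP (size (msupp p)).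
elim: r p => // r IH p; rewrite ltnS => szp /mpolyOverP pB pf.
apply/eqP/negPn/negP => p0; pose m0 := mlead p.
have c0 : p@_m0 != 0 by rewrite -mcoeff_msupp mlead_supp.
pose p' := (p@_m0)^-1 *: p.
have p'B : p' \is a mpolyOver n (gen B).
  by apply/mpolyOverP => m; rewrite mcoeffZ rpredM ?rpredV.
have p'f : p'.@[fun i => f i] = 0 by rewrite mevalZ pf mulr0.
pose q := map_mpoly sigma p' - p'.
have qE m : q@_m = sigma p'@_m - p'@_m by rewrite mcoeffB mcoeff_map_mpoly.
have q0 : q = 0.
  apply: IH.
  (* The coefficient of [p'] at [m0] is [1], so [m0] leaves the support, and [q] has strictly fewer
     monomials than [p]. *)
  - apply: leq_trans szp; rewrite -[(size _).+1]/(size (m0 :: msupp q)).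
    apply: uniq_leq_size => [|m].
      rewrite /= msupp_uniq andbT mcoeff_msupp qE mcoeffZ mulVf //.
      by rewrite rmorph1 subrr eqxx.
    rewrite inE => /predU1P[->|]; first exact: mlead_supp.
    rewrite !mcoeff_msupp qE mcoeffZ; apply: contraNneq => ->.
    by rewrite mulr0 rmorph0 subrr.
  - apply/mpolyOverP => m; rewrite qE rpredB ?sigma_gen //;
    exact: (mpolyOverP _ p'B).
  rewrite mevalB p'f subr0 -[RHS](rmorph0 sigma) -p'f -meval_map_mpoly.
  by apply: meval_eq => i; rewrite ff.
(* [q = 0] says that [sigma] fixes the coefficients of [p'], so independence over the fixed elements
   applies to [p']. *)
have : p' = 0.
  apply: hf => //; apply/mpolyOverP => m; apply: gen_base; split.
    exact: (mpolyOverP _ p'B).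
  by apply/eqP; rewrite -subr_eq0 -qE q0 mcoeff0.
by move/eqP; rewrite scaler_eq0 invr_eq0 (negPf c0) (negPf p0).
Qed.

End FixedField.

(** * Transport along field morphisms *)

Lemma gen_rmorph (K L : fieldType) (h : {rmorphism K -> L}) (B : K -> Prop) x :
  x \in gen B -> h x \in gen (fun z => exists2 y, B y & z = h y).
Proof.
move=> /genP; elim=> {x} [y By||y z _ gy _ gz|y z _ gy _ gz].
- by apply: gen_base; exists y.
- by rewrite rmorph1 rpred1.
- by rewrite rmorphB rpredB.
- by rewrite fmorph_div rpred_div.
Qed.

Lemma cl_rmorph (K L : fieldType) (h : {rmorphism K -> L}) (B : K -> Prop) x :
  cl B x -> cl (fun z => exists2 y, B y & z = h y) (h x).
Proof.
move=> [p [p0 /polyOverP pB px]]; exists (map_poly h p); split.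
- by rewrite map_poly_eq0.
- by apply/polyOverP => i; rewrite coef_map gen_rmorph.
- exact: rmorph_root.
Qed.

Lemma gen_range (K L : fieldType) (h : {rmorphism K -> L}) x :
  x \in gen (fun z => exists y, z = h y) -> exists y, x = h y.
Proof.
move=> /genP; elim=> {x} [//||_ _ _ [y ->] _ [z ->]|_ _ _ [y ->] _ [z ->]].
- by exists 1; rewrite rmorph1.
- by exists (y - z); rewrite rmorphB.
- by exists (y / z); rewrite fmorph_div.
Qed.

(** * Transcendence degree through independent sequences *)

Section TranscendenceDegree.
Variables (k : closedFieldType) (K : fieldType) (iota : {rmorphism k -> K}).
Implicit Types S : K -> Prop.

Definition cst : K -> Prop := fun z => exists y, z = iota y.

(** The image of [iota] is already a subfield, so a relation over [gen cst] lifts coefficientwise to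
    a polynomial over [k]; injectivity of [iota] gives the other direction. *)
Lemma alg_indepP n (f : nat -> K) :
  alg_indep iota (fun i : 'I_n => f i) <-> indep cst (mkseq f n).
Proof.
rewrite -mindepP; split=> h p; last first.
  rewrite mmap_meval => /h pE.
  have p0 : map_mpoly iota p = 0.
    apply: pE; apply/mpolyOverP => m; rewrite mcoeff_map_mpoly.
    by apply: gen_base; exists p@_m.
  apply/mpolyP => m; apply: (fmorph_inj iota).
  by rewrite -mcoeff_map_mpoly p0 !mcoeff0 rmorph0.
move=> /mpolyOverP pk pf.
have /choice[c cE] m : exists y, p@_m = iota y by apply: gen_range.
pose q := \sum_(m <- msupp p) c m *: 'X_[m] : {mpoly k[n]}.
have qE : map_mpoly iota q = p.
  rewrite [RHS]mpolyE rmorph_sum; apply: eq_bigr => m _ /=.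
  by rewrite map_mpolyZ map_mpolyX -cE.
by rewrite -qE (h q) ?rmorph0 // mmap_meval qE.
Qed.

Lemma alg_indep_seqP S r :
  (exists f : 'I_r -> K, (forall i, S (f i)) /\ alg_indep iota f) <->
  (exists s, [/\ size s = r, forall x, x \in s -> S x & indep cst s]).
Proof.
split=> [[f [fS hf]]|[s [<- sS hs]]].
  exists (mkseq (nth 0 (mktuple f)) r); rewrite size_mkseq; split=> //.
    move=> x /mapP[i]; rewrite mem_iota add0n /= => ir ->.
    by have := tnth_nth 0 (mktuple f) (Ordinal ir); rewrite tnth_mktuple => <-.
  apply/alg_indepP; suff -> : (fun i : 'I_r => nth 0 (mktuple f) i) = f by [].
  by apply/funext => i; rewrite -[RHS](tnth_mktuple f) (tnth_nth 0).
exists (fun i => s`_i); split=> [i|]; first exact/sS/mem_nth.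
by apply/alg_indepP; rewrite mkseq_nth.
Qed.

(** An element of [S] transcendental over a family of maximal size could be appended to it. *)
Lemma trdeg_spanning S d : is_trdeg iota S d -> exists s,
  [/\ size s = d, forall x, x \in s -> S x, indep cst s &
      forall x, S x -> cl (adj cst s) x].
Proof.
move=> [/alg_indep_seqP[s [sz sS hs]] smax]; exists s; split=> // x Sx.
apply: contrapT => nx; suff: (d.+1 <= d)%N by rewrite ltnn.
apply: smax; apply/alg_indep_seqP; exists (rcons s x).
split; [by rewrite size_rcons sz| |exact/indep_rcons].
by move=> y; rewrite mem_rcons inE => /predU1P[->|/sS].
Qed.

(** [steinitz] bounds independent families by [size t], and the empty family is one, so a largest
    size exists. *)
Lemma trdeg_ex S t : (forall x, S x -> cl (adj cst t) x) ->
  exists d, is_trdeg iota S d.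
Proof.
move=> St; pose P r := `[< exists f : 'I_r -> K,
  (forall i, S (f i)) /\ alg_indep iota f >].
have Pmax r : P r -> (r <= size t)%N.
  by move=> /asboolP/alg_indep_seqP[s [<- sS /steinitz]]; apply=> x /sS/St.
have P0 : exists r, P r.
  by exists 0; apply/asboolP/alg_indep_seqP; exists [::].
exists (ex_maxn P0 Pmax); case: ex_maxnP => d /asboolP Pd dmax.
by split=> // r Pr; apply: dmax; apply/asboolP.
Qed.

End TranscendenceDegree.

(** * The bound on the fixed field, for abstract fields *)

Section ProductBound.
Variables (k : closedFieldType) (K1 K2 L : fieldType).
Variables (iota1 : {rmorphism k -> K1}) (iota2 : {rmorphism k -> K2}).
Variables (iota : {rmorphism k -> L}).
Variables (h1 : {rmorphism K1 -> L}) (h2 : {rmorphism K2 -> L}).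
Variables (sigma2 : {rmorphism K2 -> K2}) (sigma : {rmorphism L -> L}).
Hypothesis h1_iota : forall c, h1 (iota1 c) = iota c.
Hypothesis h2_iota : forall c, h2 (iota2 c) = iota c.
Hypothesis h2_sigma : forall x, sigma (h2 x) = h2 (sigma2 x).
Hypothesis L_gen : forall z : L,
  z \in gen (fun z => (exists x, z = h1 x) \/ (exists y, z = h2 y)).

(** Applied with [K1], [K2], [L] the function fields of X, Y and X x Y, with [h1], [h2] the
    pullbacks along the projections, and with [sigma2], [sigma] induced by the maps of Y and X x
    Y. *)
Lemma trdeg_fixed_le d b a :
  is_trdeg iota1 (fun _ => True) d ->
  is_trdeg iota2 (fun y => sigma2 y = y) b ->
  is_trdeg iota (fun z => sigma z = z) a -> (a <= b + d)%N.
Proof.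
move=> /trdeg_spanning[s [<- _ _ sK1]] /trdeg_spanning[t [<- _ _ tK2]].
move=> /trdeg_spanning[g [<- gfix gindep _]].
pose K2L : L -> Prop := fun z => exists y, z = h2 y.
(* [g] is algebraic over the constants, [h2 t] and [u]; Steinitz yields the summand [size t] and
   reduces the claim to [size u <= size s]. *)
have [u [ug uindep gu]] := indep_extend (adj (cst iota) (map h2 t)) g.
have gle : (size g <= size t + size u)%N.
  rewrite -(size_map h2) -size_cat; apply: steinitz gindep _ => z /gu.
  by rewrite adj_cat.
apply: leq_trans gle _; rewrite leq_add2l -(size_map h1 s).
have hC (K : fieldType) (j : {rmorphism k -> K}) (h : {rmorphism K -> L})
    (v : seq K) : (forall c, h (j c) = iota c) ->
    forall x, cl (adj (cst j) v) x -> cl (adj (cst iota) (map h v)) (h x).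
  move=> hj x /(cl_rmorph h); apply: cl_mono => _ [y [[c ->]|yv] ->].
    by left; exists c.
  by right; apply: map_f.
have uK2 : indep K2L u.
  rewrite -[u](mkseq_nth 0); apply/mindepP.
  apply: (@mindep_fixed _ sigma).
  - by move=> _ [y ->]; rewrite h2_sigma; apply: gen_base; exists (sigma2 y).
  - by move=> i i_u; apply/gfix/ug/mem_nth.
  apply/mindepP; rewrite mkseq_nth; apply: indep_cl uindep.
  (* A fixed element of the image of [h2] is [h2 y] with [y] fixed by [sigma2], as [h2] is
     injective; hence it is algebraic over [h2 t] and the constants, over which [u] is
     independent. *)
  move=> _ [/gen_range[y ->]]; rewrite h2_sigma => /fmorph_inj yfix.
  by apply: (hC _ _ _ _ h2_iota); apply: tK2.
(* All of [L] is algebraic over [K2L] and [h1 s], so a second Steinitz exchange bounds [u]. *)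
apply: (steinitz uK2) => z _; apply: cl_gen (L_gen z) => w [[x ->]|[y ->]].
  apply: cl_adj (hC _ _ _ _ h1_iota x (sK1 x I)) => _ [c ->].
  by apply: cl_base; exists (iota2 c).
by apply: cl_base; left; exists y.
Qed.

End ProductBound.

(** * Pullback as a field morphism over [k] *)

Section PullbackMorphism.
Variables (k : closedFieldType) (N M : nat) (X : variety k N) (Y : variety k M).
Variables (f : ratmap X Y) (df : dominant f).

Fact pullback_zmod : zmod_morphism (pullback df).
Proof.
elim/quotW=> r; elim/quotW=> s.
rewrite -[X in pullback _ (_ + X)]pi_opp -[X in pullback _ X]pi_add.
rewrite !pullback_pi.
rewrite -[X in _ = _ + X]pi_opp -[RHS]pi_add.
apply/ratfunP => /=; rewrite !(rmorphD, rmorphM, rmorphN) /=.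
rewrite [X in vanishes _ X](_ : _ = 0); [exact: vanishes0|ring].
Qed.

Fact pullback_monoid : monoid_morphism (pullback df).
Proof.
split; last first.
  elim/quotW=> r; elim/quotW=> s.
  rewrite -[X in pullback _ X]pi_mul !pullback_pi -[RHS]pi_mul.
  apply/ratfunP => /=; rewrite !rmorphM /=.
  rewrite [X in vanishes _ X](_ : _ = 0); [exact: vanishes0|ring].
rewrite -[1]/(ratfun_const _ 1) /ratfun_const pullback_pi; apply/ratfunP => /=.
rewrite !mpolyC1 rmorph1.
rewrite [X in vanishes _ X](_ : _ = 0); [exact: vanishes0|ring].
Qed.

HB.instance Definition _ :=
  GRing.isZmodMorphism.Build (ratfun Y) (ratfun X) (pullback df) pullback_zmod.
HB.instance Definition _ :=
  GRing.isMonoidMorphism.Build (ratfun Y) (ratfun X) (pullback df)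
    pullback_monoid.

Lemma pullback_const c : pullback df (ratfun_const Y c) = ratfun_const X c.
Proof.
rewrite /ratfun_const pullback_pi; apply/ratfunP => /=.
rewrite comp_mpolyC rmorph1 subrr; exact: vanishes0.
Qed.

End PullbackMorphism.

(** * Effect of scaling on forms *)

Lemma map_at_scale (k : closedFieldType) N M (F : M.-tuple {mpoly k[N]}) d c x :
  (forall j, tnth F j \is d.-homog) ->
  map_at F (c *: x) = c ^+ d *: map_at F x.
Proof.
by move=> Fd; apply/rowP => j; rewrite !mxE (meval_scale _ _ (Fd j)).
Qed.

(** A quotient of forms of equal degree is invariant under scaling; the cross-multiplied form also
    covers zero scalars and zeros of [q]. *)
Lemma meval_cross (k : closedFieldType) n d (p q : {mpoly k[n]}) c e
    (x : 'rV[k]_n) : p \is d.-homog -> q \is d.-homog ->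
  p.@[(c *: x) 0] * q.@[(e *: x) 0] = p.@[(e *: x) 0] * q.@[(c *: x) 0].
Proof.
move=> hp hq; rewrite !(meval_scale _ _ hp) !(meval_scale _ _ hq).
by rewrite mulrACA [X in X * _]mulrC mulrACA.
Qed.

(** * Generation of the function field by coordinate ratios *)

Section Coordinates.
Variables (k : closedFieldType) (N : nat) (X : variety k N) (a : 'I_N).
Hypothesis Xa : ~ vanishes X 'X_a.

Definition coord_fun (i : 'I_N) : ratfun X :=
  \pi_(ratfun X) (Ratio (X_homog k i) (X_homog k a) Xa).

Lemma Xa_pow d : ('X_a ^+ d : {mpoly k[N]}) \is d.-homog.
Proof. by have := dhomogMn d (X_homog k a); rewrite mul1n. Qed.

Lemma vanishes_Xa_pow d : ~ vanishes X ('X_a ^+ d).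
Proof.
elim: d => [|d IH]; first exact: not_vanishes1.
by rewrite exprS => /(vanishesM (X_homog k a) (Xa_pow d))[].
Qed.

Definition dehomog d p (hp : p \is d.-homog) : ratfun X :=
  \pi_(ratfun X) (Ratio hp (Xa_pow d) (@vanishes_Xa_pow d)).

Variable S : divringClosed (ratfun X).
Hypothesis S_const : forall c, ratfun_const X c \in S.
Hypothesis S_coord : forall i, coord_fun i \in S.

(** Dividing by powers of ['X_a] is multiplicative, which reduces to single variables. As [dehomog]
    depends on a homogeneity proof, that proof is bound existentially and built along with the
    product. *)
Lemma dehomog_monomial (m : 'X_{1..N}) :
  exists hp : 'X_[m] \is (mdeg m).-homog, dehomog hp \in S.
Proof.
pose G d (p : {mpoly k[N]}) := exists hp : p \is d.-homog, dehomog hp \in S.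
have G1 : G 0 1.
  exists (dhomog1 _ _); rewrite -[X in X \in S]/(dehomog _).
  rewrite (_ : dehomog _ = 1) ?rpred1 //; apply/ratfunP => /=.
  rewrite mpolyC1 expr0 subrr; exact: vanishes0.
have GM d e p q : G d p -> G e q -> G (d + e)%N (p * q).
  move=> [hp Sp] [hq Sq]; exists (dhomogM hp hq).
  rewrite (_ : dehomog _ = dehomog hp * dehomog hq) ?rpredM //.
  rewrite -[RHS]pi_mul; apply/ratfunP => /=; rewrite exprD subrr.
  exact: vanishes0.
have GX i : G 1 'X_i.
  exists (X_homog k i); rewrite (_ : dehomog _ = coord_fun i) //.
  apply/ratfunP => /=; rewrite expr1 subrr; exact: vanishes0.
have GXn i n : G n ('X_i ^+ n).
  by elim: n => [//|n IH]; rewrite exprS -add1n; apply: GM.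
rewrite -/(G _ _) mdegE mpolyXE_id.
by elim/big_rec2: _ => // i p d _; apply: GM.
Qed.

Lemma dehomog_in d p (hp : p \is d.-homog) : dehomog hp \in S.
Proof.
have [hp' Sp] : exists hp : p \is d.-homog, dehomog hp \in S; last first.
  by rewrite (_ : hp = hp') //; apply: bool_irrelevance.
rewrite (mpolyE p) big_seq.
elim/big_ind: _ => [|q r [hq Sq] [hr Sr]|m hm].
- exists (rpred0 _); rewrite (_ : dehomog _ = 0) ?rpred0 //.
  apply/ratfunP => /=; rewrite mpolyC0 !mul0r subrr; exact: vanishes0.
- exists (rpredD hq hr).
  rewrite (_ : dehomog _ = dehomog hq + dehomog hr) ?rpredD //.
  rewrite -[RHS]pi_add; apply/ratfunP => /=.
  rewrite [X in vanishes _ X](_ : _ = 0); [exact: vanishes0|ring].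
have md : mdeg m = d by exact: (dhomog_mf hp hm).
have [] := dehomog_monomial m; rewrite md => hm' Sm.
exists (dhomogZ _ hm').
rewrite (_ : dehomog _ = ratfun_const X p@_m * dehomog hm') ?rpredM //.
rewrite -[RHS]pi_mul; apply/ratfunP => /=; rewrite -mul_mpolyC.
rewrite [X in vanishes _ X](_ : _ = 0); [exact: vanishes0|ring].
Qed.

(** Numerator and denominator have the same degree, so dividing both by the same power of ['X_a]
    presents [x] as a quotient of dehomogenised forms. *)
Lemma ratfun_in (x : ratfun X) : x \in S.
Proof.
elim/quotW: x => r.
suff -> : \pi_(ratfun X) r = dehomog (num_homog r) / dehomog (den_homog r).
  by rewrite rpred_div ?dehomog_in.
have D0 : dehomog (den_homog r) != 0.
  apply/eqP => /ratfunP /=; rewrite mpolyC0 mulr1 mul0r subr0.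
  exact: den_neq0.
apply/esym/(canLR (mulfK D0)).
rewrite -[RHS]pi_mul; apply/ratfunP => /=.
rewrite [X in vanishes _ X](_ : _ = 0); [exact: vanishes0|ring].
Qed.

End Coordinates.

(** The finitely many coordinate ratios generate the function field over [k]; this serves both for
    the whole field and for fixed subfields. *)
Lemma ratfun_trdeg_ex (k : closedFieldType) N (X : variety k N) S :
  exists d, is_trdeg (@ratfun_const _ _ X) S d.
Proof.
pose t := codom (coord_fun (coordP (X := X))).
apply: (@trdeg_ex _ _ _ _ t) => x _.
suff: x \in gen (adj (cst (@ratfun_const _ _ X)) t).
  by apply: cl_gen => z; apply: cl_base.
apply: (@ratfun_in _ _ _ _ (coordP (X := X))) => [c|i].
  by apply: gen_base; left; exists c.
by apply: gen_base; right; apply: codom_f.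
Qed.

(** * Projections from a product in Segre coordinates *)

Section Projections.
Variables (k : closedFieldType) (N M : nat) (X : variety k N) (Y : variety k M).
Let V := prod_variety X Y.
Let a := coord X.
Let b := coord Y.
Let ab : 'I_(N * M) := mxvec_index a b.

Lemma coord_point n (Z : variety k n) : exists2 x, Z x & x 0 (coord Z) != 0.
Proof.
have /existsNP[x /not_implyP[Zx /eqP]] := coordP (X := Z).
by rewrite mevalXU; exists x.
Qed.

Lemma prod_coordP : ~ vanishes V 'X_ab.
Proof.
have [x Xx xa] := coord_point X; have [y Yy yb] := coord_point Y.
have Vxy : V (segre x y) by exists x, y.
move=> /(_ _ Vxy)/eqP; rewrite mevalXU segreE.
by rewrite (negPf (mulf_neq0 xa yb)).
Qed.

(** The open set is where the coordinate [ab] is nonzero. On it [z_ab = x_a y_b] makes [x_a] and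
    [y_b] nonzero, and these are the scalars up to which row [a] and column [b] recover [y] and
    [x]. *)
Lemma proj_generic n (Z : variety k n) (F : n.-tuple {mpoly k[N * M]}) :
  (forall x y, X x -> Y y -> x 0 a != 0 -> y 0 b != 0 ->
    Z (map_at F (segre x y))) ->
  exists B, [/\ proj_closed B, exists z, V z /\ ~ B z &
    forall z, V z -> ~ B z -> Z (map_at F z)].
Proof.
move=> hF; exists (zeros (eq^~ 'X_ab)); split.
- exact: form_zeros_closed (X_homog k ab).
- have /existsNP[z /not_implyP[Vz hz]] := prod_coordP.
  by exists z; split=> // -[_ /(_ _ erefl)].
move=> z Vz; have [x [y [Xx Yy zE]]] := Vz => hz.
have : z 0 ab != 0.
  apply/eqP => z0; apply: hz; split=> [|_ ->]; first exact: variety_neq0 Vz.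
  by rewrite mevalXU.
by rewrite zE segreE mulf_eq0 => /norP[? ?]; apply: hF.
Qed.

Fact fst_generic : exists B, [/\ proj_closed B, exists z, V z /\ ~ B z &
  forall z, V z -> ~ B z -> X (map_at (zcol k N b) z)].
Proof.
by apply: proj_generic => x y Xx Yy _ yb; rewrite zcol_segre variety_scale.
Qed.

Fact snd_generic : exists B, [/\ proj_closed B, exists z, V z /\ ~ B z &
  forall z, V z -> ~ B z -> Y (map_at (zrow k M a) z)].
Proof.
by apply: proj_generic => x y Xx Yy xa _; rewrite zrow_segre variety_scale.
Qed.

Definition proj_fst : ratmap V X := RatMap (zcol_homog k b) fst_generic.
Definition proj_snd : ratmap V Y := RatMap (zrow_homog k a) snd_generic.

Fact fst_dominant : dominant proj_fst.
Proof.
move=> A cA hA x Xx; have [y Yy yb] := coord_point Y.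
rewrite -(closed_scale x cA yb) -zcol_segre; apply: hA; first by exists x, y.
by rewrite zcol_segre variety_scale.
Qed.

Fact snd_dominant : dominant proj_snd.
Proof.
move=> A cA hA y Yy; have [x Xx xa] := coord_point X.
rewrite -(closed_scale y cA xa) -zrow_segre; apply: hA; first by exists x, y.
by rewrite zrow_segre variety_scale.
Qed.

Lemma prod_ratfun_gen (z : ratfun V) :
  z \in gen (fun z => (exists x, z = pullback fst_dominant x) \/
                      (exists y, z = pullback snd_dominant y)).
Proof.
apply: (@ratfun_in _ _ _ _ prod_coordP) => [c|l].
  by apply: gen_base; left; exists (ratfun_const X c); rewrite pullback_const.
case/mxvec_indexP: l => i j.
(* In Segre coordinates [z_ij / z_ab = (x_i / x_a) (y_j / y_b)]. *)
rewrite (_ : coord_fun _ _ = pullback fst_dominant (coord_fun (coordP (X:=X)) i)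
  * pullback snd_dominant (coord_fun (coordP (X:=Y)) j)).
  by apply: rpredM; apply: gen_base; [left|right]; eexists.
rewrite !pullback_pi -[RHS]pi_mul; apply/ratfunP => /=.
rewrite !comp_mpolyXU -!tnth_nth !tnth_mktuple => _ [x [y [_ _ ->]]].
rewrite mevalB !mevalM !mevalXU !segreE -/a -/b; ring.
Qed.

End Projections.

(** * Product systems and the stabilised dimension *)

Lemma prod_map_snd (k : closedFieldType) N M (X : rds k N) (Y : rds k M)
    (r : ratfun Y) :
  pullback (@rds_dominant _ _ (prod_rds X Y))
    (pullback (@snd_dominant _ _ _ X Y) r) =
  pullback (@snd_dominant _ _ _ X Y) (pullback (@rds_dominant _ _ Y) r).
Proof.
rewrite !pullback_pi; apply/ratfunP => /=.
move=> _ [x [y [Xx Yy ->]]]; rewrite mevalB !mevalM !comp_meval.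
(* At [segre x y] both composites are multiples of one vector, the image of [y] under the map of
   [Y]; [meval_cross] then discards the scalars. *)
rewrite prod_formE (map_at_scale _ _ (zrow_homog k _)) !zrow_segre.
rewrite (map_at_scale _ _ (ratmap_homog (rds_map Y))) !scalerA.
by rewrite (meval_cross _ _ _ (num_homog _) (den_homog _)) subrr.
Qed.

Lemma adim_prod_le (k : closedFieldType) N M (X : rds k N) (Y : rds k M) a b d :
  is_adim (prod_rds X Y) a -> is_adim Y b -> is_dim X d -> (a <= b + d)%N.
Proof.
move=> ha hb hd.
apply: (@trdeg_fixed_le _ _ _ _ _ _ _ (pullback (@fst_dominant _ _ _ X Y))
  (pullback (@snd_dominant _ _ _ X Y)) (pullback (@rds_dominant _ _ Y))
  (pullback (@rds_dominant _ _ (prod_rds X Y))) _ _ _ _ _ _ _ hd hb ha).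
- exact: pullback_const.
- exact: pullback_const.
- exact: prod_map_snd.
- exact: prod_ratfun_gen.
Qed.

(** A largest [e] corresponds to a least distance [d - e], which is a natural number. *)
Lemma bounded_int_max (P : int -> Prop) (d : int) :
  (exists e, P e) -> (forall e, P e -> e <= d) -> exists s, is_max P s.
Proof.
move=> [e Pe] Pd; pose Q n := `[< P (d - n%:Z) >].
have QP i : P i -> Q `|d - i|%N.
  move=> Pi; apply/asboolP; rewrite gez0_abs ?subr_ge0 ?Pd //.
  by rewrite opprB addrCA subrr addr0.
have exQ : exists n, Q n by exists `|d - e|%N; apply: QP.
exists (d - (ex_minn exQ)%:Z); case: ex_minnP => n /asboolP Pn nmin.
split=> // i Pi; have := nmin _ (QP i Pi); have := Pd i Pi; lia.
Qed.

(** The dimensions are relations, so existence of the maximum defining sadim is proved as well;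
    maxima being unique, the inequality concerns the actual values. *)
Theorem corollary4p2 (k : closedFieldType) (N : nat) (X : rds k N) :
  exists (s : int) (d : nat), [/\ is_sadim X s, is_dim X d & s <= d%:Z].
Proof.
have [d hd] : exists d, is_dim X d by apply: ratfun_trdeg_ex.
have le_d e : (exists M (Y : rds k M) (a b : nat),
    [/\ is_adim (prod_rds X Y) a, is_adim Y b & e = a%:Z - b%:Z]) -> e <= d%:Z.
  by move=> [M [Y [a [b [ha hb ->]]]]]; have := adim_prod_le ha hb hd; lia.
have [|s hs] := bounded_int_max _ le_d.
  (* The system [X] itself, taken as [Y], shows that the set of differences is nonempty. *)
  have [a ha] := ratfun_trdeg_ex (@Fix _ _ (prod_rds X X)).
  have [b hb] := ratfun_trdeg_ex (@Fix _ _ X).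
  by exists (a%:Z - b%:Z), N, X, a, b.
by exists s, d; split=> //; apply: le_d; case: hs.
Qed.
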